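(* Let $(M,g)$ be a compact Riemannian surface without boundary, and let $0<a\le b<+\infty$ be constants. For each $\epsilon>0$ let $V_\epsilon:M\to\mathbb{R}$ be a Hölder continuous function with $a\le V_\epsilon(x)\le b$ for all $x\in M$, and assume that $V_\epsilon\to V$ in $L^\infty(M)$ as $\epsilon\to 0$ for some function $V$. For each $\epsilon>0$ let $u_\epsilon\in C^2(M)$ be a solution of $$\Delta u_\epsilon+\epsilon=V_\epsilon e^{u_\epsilon}\quad\text{on } M .$$ Then $$\sup_M u_\epsilon\to-\infty\quad\text{as }\epsilon\to 0 .$$
   Context: $\Delta=-\nabla_i\nabla^i$ denotes the Laplace–Beltrami operator of $(M,g)$ with the geometers' sign convention (a nonnegative operator, i.e. minus the divergence of the gradient). The constants $a,b$ do not depend on $\epsilon$; the Hölder exponents and norms of $V_\epsilon$ are not assumed uniform in $\epsilon$. *)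

(* Defs.v *)
From HB Require Import structures.
From mathcomp Require Import all_boot all_order all_algebra.
From mathcomp Require Import all_classical all_reals all_analysis.
Set Implicit Arguments.
Unset Strict Implicit.
Unset Printing Implicit Defensive.
Import Order.TTheory GRing.Theory Num.Theory.
Import numFieldNormedType.Exports.
Local Open Scope classical_set_scope.
Local Open Scope ring_scope.

(* Charts take values in the plane R * R; its two coordinates are indexed by
   'I_2 so that tensors can be written as matrices. *)
Definition coord (R : realType) (a : 'I_2) (p : R * R) : R :=
  if a == ord0 then p.1 else p.2.

Definition basis_vec (R : realType) (a : 'I_2) : R * R :=
  ((a == ord0)%:R, (a != ord0)%:R).

Definition partial (R : realType) (a : 'I_2) (f : R * R -> R) (p : R * R) : R :=
  'D_(basis_vec R a) f p.

(* f is of class C^k on D; meant for open D, where only the values of f on D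
   matter. *)
Fixpoint Ck (R : realType) (k : nat) (D : set (R * R)) (f : R * R -> R) : Prop :=
  (forall p, D p -> {for p, continuous f}) /\
  match k with
  | 0 => True
  | k'.+1 => forall a : 'I_2,
      (forall p, D p -> derivable f p (basis_vec R a)) /\ Ck k' D (partial a f)
  end.

Definition smooth_on (R : realType) (D : set (R * R)) (f : R * R -> R) : Prop :=
  forall k, Ck k D f.

(* A smooth atlas on M by charts with values in the plane.  The maps
   [chart i] and [param i] are total, but only [chart i] on [chart_dom i] and
   [param i] on the image of [chart_dom i] are meaningful: there they are
   mutually inverse homeomorphisms between open sets. *)
Record smooth_surface (R : realType) (M : topologicalType) := SmoothSurface {
  chart_index : Type ;
  chart_dom : chart_index -> set M ;
  chart : chart_index -> M -> R * R ;
  param : chart_index -> R * R -> M ;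
  chart_dom_open : forall i, open (chart_dom i) ;
  chart_dom_cover : forall x, exists i, chart_dom i x ;
  chart_image_open : forall i, open (chart i @` chart_dom i) ;
  chartK : forall i x, chart_dom i x -> param i (chart i x) = x ;
  chart_continuous : forall i x,
    chart_dom i x -> {for x, continuous (chart i)} ;
  param_continuous : forall i p,
    (chart i @` chart_dom i) p -> {for p, continuous (param i)} ;
  transition_smooth : forall i j (a : 'I_2),
    smooth_on (chart i @` (chart_dom i `&` chart_dom j))
              (fun p => coord a (chart j (param i p)))
}.

Definition chart_image (R : realType) (M : topologicalType)
  (S : smooth_surface R M) (i : chart_index S) : set (R * R) :=
  chart i @` chart_dom i.

(* Row a, column b: derivative in direction a of the b-th coordinate of the
   transition map from chart i to chart j. *)
Definition transition_jacobian (R : realType) (M : topologicalType)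
  (S : smooth_surface R M) (i j : chart_index S) (p : R * R) : 'M[R]_2 :=
  \matrix_(a, b) partial a (fun q => coord b (chart j (param i q))) p.

(* A smooth Riemannian metric, given by its matrices of components (g_ab) in
   the charts; the last field says that these are the components of a single
   covariant 2-tensor on M. *)
Record riemannian_metric (R : realType) (M : topologicalType)
    (S : smooth_surface R M) := RiemannianMetric {
  metric_mx : chart_index S -> R * R -> 'M[R]_2 ;
  metric_smooth : forall i (a b : 'I_2),
    smooth_on (chart_image i) (fun p => metric_mx i p a b) ;
  metric_sym : forall i p, chart_image i p ->
    (metric_mx i p)^T = metric_mx i p ;
  metric_pos : forall i p (v : 'rV[R]_2), chart_image i p -> v != 0 ->
    0 < (v *m metric_mx i p *m v^T) ord0 ord0 ;
  metric_compat : forall i j p,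
    (chart i @` (chart_dom i `&` chart_dom j)) p ->
    metric_mx i p = transition_jacobian i j p
      *m metric_mx j (chart j (param i p)) *m (transition_jacobian i j p)^T
}.

Definition C2_on_surface (R : realType) (M : topologicalType)
  (S : smooth_surface R M) (u : M -> R) : Prop :=
  forall i : chart_index S, Ck 2 (chart_image i) (fun p => u (param i p)).

Section LaplaceBeltrami.
Context (R : realType) (M : topologicalType) (S : smooth_surface R M)
  (g : riemannian_metric S).

Definition volume_density (i : chart_index S) (p : R * R) : R :=
  Num.sqrt (\det (metric_mx g i p)).

Definition gradient (i : chart_index S) (f : R * R -> R) (a : 'I_2)
    (p : R * R) : R :=
  \sum_(b < 2) invmx (metric_mx g i p) a b * partial b f p.

Definition divergence (i : chart_index S) (X : 'I_2 -> R * R -> R)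
    (p : R * R) : R :=
  (volume_density i p)^-1 *
  \sum_(a < 2) partial a (fun q => volume_density i q * X a q) p.

(* - div (grad u) at x, computed in the chart i; for x in the domain of i and
   u of class C^2 the value does not depend on i. *)
Definition laplace_beltrami (i : chart_index S) (u : M -> R) (x : M) : R :=
  - divergence i (gradient i (fun p => u (param i p))) (chart i x).

End LaplaceBeltrami.

Section RiemannianDistance.
Context (R : realType) (M : topologicalType) (S : smooth_surface R M)
  (g : riemannian_metric S).

(* A C^1 arc parametrized by [0, 1], contained in the chart i and read there.
   Asking for c to be C^1 on the whole line is no restriction, since a C^1 map
   on [0, 1] extends. *)
Definition C1_arc (i : chart_index S) (c : R -> R * R) : Prop :=
  (forall t, `[0, 1]%classic t -> chart_image i (c t)) /\
  forall a : 'I_2,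
    (forall t : R, derivable (fun s => coord a (c s)) t 1) /\
    continuous (derive1 (fun s => coord a (c s))).

Definition arc_speed (i : chart_index S) (c : R -> R * R) (t : R) : R :=
  Num.sqrt (\sum_(a < 2) \sum_(b < 2) metric_mx g i (c t) a b *
    derive1 (fun s => coord a (c s)) t * derive1 (fun s => coord b (c s)) t).

Definition arc_length (i : chart_index S) (c : R -> R * R) : \bar R :=
  (\int[lebesgue_measure]_(t in `[0%R, 1%R]) (arc_speed i c t)%:E)%E.

(* [path_length x y l]: some piecewise C^1 path from x to y has length l.  By
   compactness of [0, 1], every such path is a finite concatenation of arcs
   each contained in one chart. *)
Inductive path_length : M -> M -> \bar R -> Prop :=
| path_nil x : path_length x x 0%E
| path_cons (i : chart_index S) (c : R -> R * R) y l :
    C1_arc i c -> path_length (param i (c 1)) y l ->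
    path_length (param i (c 0)) y (arc_length i c + l)%E.

(* +oo between distinct connected components *)
Definition riemannian_dist (x y : M) : \bar R :=
  ereal_inf [set l | path_length x y l].

Definition hoelder_continuous (f : M -> R) : Prop :=
  exists alpha C : R, [/\ 0 < alpha, alpha <= 1, 0 < C &
    forall x y, (`|f x - f y|%:E <= C%:E * poweR (riemannian_dist x y) alpha)%E].

End RiemannianDistance.

(* Null sets of the Riemannian area.  In each chart the area has the positive
   continuous density [volume_density] with respect to Lebesgue measure, so its
   null sets are those that are Lebesgue-null in every chart; for an
   uncountable atlas this is still correct on a compact M. *)
Definition surface_negligible (R : realType) (M : topologicalType)
  (S : smooth_surface R M) (N : set M) : Prop :=
  forall i : chart_index S,
    (@lebesgue_measure R \x @lebesgue_measure R)%E.-negligible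
      (chart i @` (N `&` chart_dom i)).

Definition Linfty_norm (R : realType) (M : topologicalType)
  (S : smooth_surface R M) (f : M -> R) : \bar R :=
  ereal_inf [set y : \bar R | (0 <= y)%E /\
    surface_negligible S [set x | (y < `|f x|%:E)%E]].

(* Main.v *)
Require Import Defs.
From HB Require Import structures.
From mathcomp Require Import all_boot all_order all_algebra.
From mathcomp Require Import all_classical all_reals all_analysis.
From mathcomp Require Import ring lra.
Set Implicit Arguments.
Unset Strict Implicit.
Unset Printing Implicit Defensive.
Import Order.TTheory GRing.Theory Num.Theory.
Import numFieldNormedType.Exports.
Local Open Scope classical_set_scope.
Local Open Scope ring_scope.

(* In a chart the equation reads div (A grad u) = sqrt(det g) (eps - V e^u) with
   A = sqrt(det g) g^-1, a symmetric positive matrix of determinant 1.  Testing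
   div (A grad v) <= K, v >= 0, against the kernels (t^2 - Q_q)_+^3, where Q_q is
   the quadratic form of A(q)^-1, gives a differential inequality in t for the
   means of v, hence a weak Harnack inequality: means of v over small ellipses
   around q are at most a constant times v(q) + K t^2.

   Suppose e^(max u) >= c0, the maximum being attained at p.  Applied to max u - u
   at the scale t ~ e^(-max u / 2), the weak Harnack inequality shows that V e^u
   has mass at least some c > 0 near p.  Testing the equation for v = u - min_D u,
   where D is the connected component of p, turns this mass into a lower bound for
   the means of v, hence for v itself near p, up to O(eps).  Weak Harnack propagates
   the bound to all of D, by connectedness and compactness; at the minimum point of
   u over D, where v = 0, this is absurd for small eps. *)

(** The obstacle is that no upper bound on u is available: e^(max u) may be arbitrarily large and u
    may concentrate at the moving point p, so no constant may depend on max u. Dimension two is what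
    helps: on average V e^u is comparable to e^(max u) over an area of order e^(-max u), hence the
    mass found at this scale is bounded below however high the maximum is.

    Integrating the equation over the component would bound the total mass by eps times the area.
    The proof stays inside charts instead, and the smallness of eps is felt at the minimum of u.
    Each passage from one chart to another costs a constant factor and an error O(eps). Therefore
    what is propagated is not a fixed lower bound but v >= n eps for every n, for eps small
    depending on n: the losses are absorbed by n, and n = 1 already contradicts v = 0 at the
    minimum.

    The power 3 in the kernel is the least one whose gradient is still C^1, as Green's identity
    requires. Freezing A at the centre q leaves errors of relative order t, which an explicit
    integrating factor absorbs. *)

Local Notation i0 := (ord0 : 'I_2).
Local Notation i1 := (ord_max : 'I_2).

Lemma ord2_cases (a : 'I_2) : a = i0 \/ a = i1.
Proof. by case: a => [[|[|]]]// i; [left|right]; exact: val_inj. Qed.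

(** * Integration of compactly supported continuous functions over the plane *)

Section plane_integral.
Context (R : realType).
Local Notation mu2 := ((@lebesgue_measure R \x @lebesgue_measure R)%E).
Implicit Types (f g : R * R -> R) (N : R).

Definition centered_box N : set (R * R) := `[- N, N] `*` `[- N, N].

(** Measurability refers to the product sigma-algebra, so [U] has to be exhibited as a countable
    union of boxes; those with rational corners suffice. *)
Lemma open_measurable_plane (U : set (R * R)) : open U ->
  measurable (U : set (measurableTypeR R * measurableTypeR R)).
Proof.
move=> oU.
pose box (i : (rat * rat) * (rat * rat)) : set (R * R) :=
  `]ratr i.1.1, ratr i.1.2[ `*` `]ratr i.2.1, ratr i.2.2[.
have -> : U = \bigcup_i (if `[< box i `<=` U >] then box i else set0).
  apply/seteqP; split => [p Up|p [i _]]; last first.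
    by case: ifPn => // /asboolP; apply.
  have /nbhs_ballP[e /= e0 eU] : nbhs p U by exact: open_nbhs_nbhs.
  have rats (x : R) : exists i : rat * rat, [/\ x - e < ratr i.1,
      ratr i.1 < x, x < ratr i.2 & ratr i.2 < x + e].
    have [l] : exists q, ratr q \in `]x - e, x[ :> Prop.
      by apply: rat_in_itvoo; rewrite ltrBlDr ltrDl.
    have [r] : exists q, ratr q \in `]x, x + e[ :> Prop.
      by apply: rat_in_itvoo; rewrite ltrDl.
    by rewrite !in_itv/= => /andP[? ?] /andP[? ?]; exists (l, r).
  have [i [i1 i2 i3 i4]] := rats p.1.
  have [j [j1 j2 j3 j4]] := rats p.2.
  exists (i, j) => //; case: ifPn => [_|/asboolP[]].
    by split; rewrite /= in_itv/=; apply/andP.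
  move=> z [/=]; rewrite !in_itv/= => /andP[? ?] /andP[? ?].
  by apply: eU; split; rewrite /ball/= ltr_norml; apply/andP; split; lra.
apply: countable_bigcupT_measurable => [|i]; first exact: countableP.
case: ifPn => // _.
exact: measurableX.
Qed.

Lemma continuous_measurable_plane f : continuous f ->
  measurable_fun (@setT (measurableTypeR R * measurableTypeR R)) f.
Proof.
move=> /continuousP cf;
  apply: (measurability _ (measurable_realfun.RGenOpens.measurableE R)).
move=> _ [_ [a [b ->] <-]]; rewrite setTI; apply: open_measurable_plane.
apply: cf; exact: interval_open.
Qed.

Definition vanishes_off N f := forall p, ~ centered_box N p -> f p = 0.

Lemma compact_centered_box N : compact (centered_box N).
Proof. by apply: compact_setX; exact: segment_compact. Qed.

Lemma measurable_centered_box N :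
  measurable (centered_box N : set (measurableTypeR R * measurableTypeR R)).
Proof. exact: measurableX. Qed.

Lemma mu2_box (a b c d : R) : a <= b -> c <= d ->
  mu2 (`[a, b] `*` `[c, d]) = ((b - a) * (d - c))%:E.
Proof.
move=> ab cd; rewrite product_measure1E//=.
rewrite !lebesgue_measure_itv/= !lte_fin.
case: ltP => [_|ba]; last by rewrite (_ : a = b) ?subrr ?mul0e ?mul0r//; lra.
case: ltP => [_|dc]; last by rewrite (_ : c = d) ?subrr ?mule0 ?mulr0//; lra.
by rewrite -!EFinD -EFinM.
Qed.

Lemma integrable_plane N f : continuous f -> vanishes_off N f ->
  mu2.-integrable setT (EFin \o f).
Proof.
move=> cf f0; have mf := continuous_measurable_plane cf.
have -> : EFin \o f = (EFin \o f) \_ (centered_box N).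
  apply/funext => p; rewrite patchE; case: ifPn => // /negP.
  by rewrite inE => /f0 /= ->.
apply/integrable_restrict => //; first exact: measurable_centered_box.
rewrite setTI; apply: measurable_bounded_integrable.
- exact: measurable_centered_box.
- rewrite /centered_box /=.
  have [N0|N0] := leP 0 N; first by rewrite mu2_box ?ltry//; lra.
  by rewrite set_itv_ge ?set0X ?measure0// bnd_simp -ltNge; lra.
- exact: measurable_funS mf.
- suff : bounded_set (f @` centered_box N).
    move=> [M [Mr fM]]; exists M; split => // x Mx y By.
    by apply: (fM x) => //; exists y.
  apply: compact_bounded; apply: continuous_compact.
    exact: continuous_subspaceT.
  exact: compact_centered_box.
Qed.

(** Compact support is recorded by a centred box. Membership in this class settles integrability in
    everything that follows. *)
Definition Cc f := continuous f /\ exists N, vanishes_off N f.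

Definition pint f : R := \int[mu2]_p f p.

Lemma Cc_integrable f : Cc f -> mu2.-integrable setT (EFin \o f).
Proof. by move=> [cf [N fN]]; exact: integrable_plane fN. Qed.

Lemma centered_box_sub N N' : N <= N' -> centered_box N `<=` centered_box N'.
Proof.
move=> NN' [x y] [/=]; rewrite !in_itv/= => /andP[? ?] /andP[? ?].
by split; rewrite /= in_itv/=; apply/andP; split; lra.
Qed.

Lemma CcD f g : Cc f -> Cc g -> Cc (fun p => f p + g p).
Proof.
move=> [cf [N fN]] [cg [N' gN']]; split.
  by move=> p; apply: cvgD; [exact: cf|exact: cg].
exists (Num.max N N') => p pN; rewrite fN ?gN' ?addr0//.
  by move=> h; apply: pN; apply: centered_box_sub h; rewrite le_max lexx orbT.
by move=> h; apply: pN; apply: centered_box_sub h; rewrite le_max lexx.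
Qed.

Lemma CcZ c f : Cc f -> Cc (fun p => c * f p).
Proof.
move=> [cf [N fN]]; split; last by exists N => p /fN ->; rewrite mulr0.
by move=> p; apply: cvgM; [exact: cvg_cst|exact: cf].
Qed.

Lemma pintD f g : Cc f -> Cc g ->
  pint (fun p => f p + g p) = pint f + pint g.
Proof. by move=> cf cg; rewrite /pint RintegralD//; exact: Cc_integrable. Qed.

Lemma pintZ c f : Cc f -> pint (fun p => c * f p) = c * pint f.
Proof. by move=> cf; rewrite /pint RintegralZl//; exact: Cc_integrable. Qed.

Lemma le_pint f g : Cc f -> Cc g -> (forall p, f p <= g p) ->
  pint f <= pint g.
Proof.
by move=> cf cg fg; apply: le_Rintegral => //; exact: Cc_integrable.
Qed.

Lemma pint_box (a b c d k : R) : a <= b -> c <= d ->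
  let B := (`[a, b] `*` `[c, d])%classic : set (measurableTypeR R * measurableTypeR R) in
  mu2.-integrable setT (EFin \o ((cst k : R * R -> R) \_ B)) /\
  \int[mu2]_p ((cst k : R * R -> R) \_ B) p = k * ((b - a) * (d - c)).
Proof.
move=> ab cd B; have mB : measurable B by exact: measurableX.
split.
  have -> : EFin \o ((cst k : R * R -> R) \_ B) = (cst k%:E : R * R -> \bar R) \_ B.
    by apply/funext => p /=; rewrite !patchE; case: ifPn.
  apply/integrable_restrict => //; rewrite setTI.
  apply: (@measurable_bounded_integrable _ _ _ mu2 (cst k)) => //.
    by have := mu2_box ab cd; rewrite /B /= => ->; rewrite ltry.
  exact: bounded_cst.
rewrite -Rintegral_mkcond Rintegral_cst//.
by have := mu2_box ab cd; rewrite /B /= => ->.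
Qed.

Lemma pint_ge_box (a b c d k : R) f : a <= b -> c <= d -> Cc f ->
  (forall p, 0 <= f p) ->
  (forall p, a <= p.1 <= b -> c <= p.2 <= d -> k <= f p) ->
  k * ((b - a) * (d - c)) <= pint f.
Proof.
move=> ab cd cf f0 fk; have [iB <-] := pint_box k ab cd.
apply: le_Rintegral => //; first exact: Cc_integrable.
move=> p _; rewrite patchE; case: ifPn => // /set_mem [/=].
by rewrite !in_itv/=; exact: fk.
Qed.

Lemma pint_le_box (a b c d k : R) f : a <= b -> c <= d -> Cc f -> 0 <= k ->
  (forall p, f p <= k) ->
  (forall p, 0 < f p -> a <= p.1 <= b /\ c <= p.2 <= d) ->
  pint f <= k * ((b - a) * (d - c)).
Proof.
move=> ab cd cf k0 fk fB; have [iB <-] := pint_box k ab cd.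
apply: le_Rintegral => //; first exact: Cc_integrable.
move=> p _; rewrite patchE; case: ifPn => // /negP; rewrite inE => pB.
rewrite leNgt; apply/negP => /fB [p1 p2]; apply: pB.
by split; rewrite /= in_itv.
Qed.

Lemma integral_derive_vanishing (F : R -> R) N :
  (forall x, derivable F x 1) -> continuous (derive1 F) ->
  (forall x, N < `|x| -> F x = 0) -> (forall x, N < `|x| -> derive1 F x = 0) ->
  (\int[lebesgue_measure]_x (derive1 F x)%:E = 0)%E.
Proof.
move=> dF cF F0 F'0; pose N' := `|N| + 1.
have N'N : N < N' by rewrite /N'; have := ler_norm N; lra.
have N'0 : 0 < N' by rewrite /N'; have := normr_ge0 N; lra.
have -> : (\int[lebesgue_measure]_x (derive1 F x)%:E =
    \int[lebesgue_measure]_(x in `[(- N')%R, N']) (derive1 F x)%:E)%E.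
  rewrite [RHS]integral_mkcond; apply: eq_integral => x _.
  rewrite patchE; case: ifPn => // /negP; rewrite inE/= in_itv/= => xN.
  rewrite F'0//; apply: (lt_le_trans N'N); rewrite leNgt; apply/negP.
  by rewrite ltr_norml => /andP[? ?]; apply: xN; apply/andP; split; exact: ltW.
have cts_F x : {for x, continuous F}.
  by apply/differentiable_continuous/derivable1_diffP/dF.
have NN' : - N' < N' by lra.
have LR : derivable_oo_LRcontinuous F (- N') N'.
  split => [x _||]; first exact: dF.
  - by apply: cvg_at_right_filter; exact: cts_F.
  - by apply: cvg_at_left_filter; exact: cts_F.
rewrite (continuous_FTC2 NN' (continuous_subspaceT cF) LR); last by move=> x.
by rewrite !F0 ?subee// ?normrN gtr0_norm.
Qed.

Lemma is_derive_slice (X : R * R -> R) (a : 'I_2) p :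
  derivable X p (basis_vec R a) ->
  is_derive (if a == ord0 then p.1 else p.2) 1
    (fun s => X (if a == ord0 then (s, p.2) else (p.1, s))) (partial a X p).
Proof.
move=> dX.
have E : (fun h : R => h^-1 *: (X (h *: basis_vec R a + p) - X p)) =
  (fun h : R => h^-1 *: (X (if a == ord0 then (h *: 1 +
    (if a == ord0 then p.1 else p.2), p.2) else (p.1,
    h *: 1 + (if a == ord0 then p.1 else p.2))) - X (if a == ord0 then (if a ==
    ord0 then p.1 else p.2, p.2) else (p.1, if a == ord0 then p.1 else p.2)))).
  apply/funext => h; case: p {dX} => x y.
  rewrite /basis_vec; case: eqP => _ /=; congr (_ *: (X _ - _)).
    by congr pair; rewrite /= scaler0 add0r.
  by congr pair; rewrite /= scaler0 add0r.
split; first by rewrite /derivable -E.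
by rewrite /partial /derive -E.
Qed.

Lemma integral_partial_slice (a : 'I_2) (X : R * R -> R) (K c : R) :
  let line s := if a == ord0 then (s, c) else (c, s) in
  (forall p, derivable X p (basis_vec R a)) -> continuous (partial a X) ->
  (forall s, K < `|s| -> X (line s) = 0 /\ partial a X (line s) = 0) ->
  (\int[lebesgue_measure]_s (partial a X (line s))%:E = 0)%E.
Proof.
move=> line dX cX' out.
have dE (s : R) : is_derive s 1 (fun s => X (line s)) (partial a X (line s)).
  by have := is_derive_slice (dX (line s)); rewrite /line; case: ifP => a0; rewrite ?a0.
have E : derive1 (fun s => X (line s)) = fun s => partial a X (line s).
  apply/funext => s.
  by rewrite derive1E (@derive_val _ _ _ _ _ _ _ (dE s)).
have cline : continuous line.
  rewrite /line; case: (a == ord0) => s.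
    exact: (cvg_pair cvg_id (cvg_cst _)).
  exact: (cvg_pair (cvg_cst _) cvg_id).
have := @integral_derive_vanishing (fun s => X (line s)) K; rewrite E; apply.
- by move=> s; apply: (@ex_derive _ _ _ _ _ _ _ (dE s)).
- move=> s; apply: (@continuous_comp _ _ _ line (partial a X)).
    exact: cline.
  exact: cX'.
- by move=> s /out[].
- by move=> s /out[].
Qed.

(** Fubini with the inner integral taken in the direction of differentiation; that integral vanishes
    by the fundamental theorem of calculus. *)
Lemma pint_partial (a : 'I_2) (X : R * R -> R) : Cc X ->
  (forall p, derivable X p (basis_vec R a)) -> Cc (partial a X) ->
  pint (partial a X) = 0.
Proof.
move=> [cX [N X0]] dX cpX; have [cX' [N' X'0]] := cpX.
have iX := Cc_integrable cpX; rewrite /pint /Rintegral.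
pose K := Num.max N N'.
have out p : (K < `|p.1|) || (K < `|p.2|) -> X p = 0 /\ partial a X p = 0.
  have outside M : M <= K -> (K < `|p.1|) || (K < `|p.2|) ->
      ~ centered_box M p.
    move=> MK pK [] /=; rewrite !in_itv/= -!ler_norml => p1 p2.
    by case/orP: pK; lra.
  by move=> pK; split; [apply: X0|apply: X'0];
    apply: outside pK; rewrite le_max lexx ?orbT.
have slice c := integral_partial_slice (K := K) (c := c) dX cX'.
suff -> : (\int[mu2]_p (partial a X p)%:E = 0)%E by [].
case: (boolP (a == ord0)) slice => _ slice.
- rewrite -(integral21_prod_meas1 iX); apply: integral0_eq => /= y _.
  by apply: slice => s Ks; apply: out; rewrite Ks.
- rewrite -(integral12_prod_meas1 iX); apply: integral0_eq => /= x _.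
  by apply: slice => s Ks; apply: out; rewrite Ks orbT.
Qed.

End plane_integral.

(** * Rules for directional derivatives *)

Section derivation_rules.
Context (R : realType) (V : normedModType R).
Implicit Types (f g : V -> R) (p e : V).

(** This rule and the next ones are stated for explicit [fun x => ...] bodies, with multiplication
    of [R] instead of scaling, the shape in which [is_derive_rules] applies them. *)
Lemma is_deriveM_fun f g p e df dg :
  is_derive p e f df -> is_derive p e g dg ->
  is_derive p e (fun x => f x * g x) (df * g p + f p * dg).
Proof.
move=> hf hg; apply: (is_derive_eq (is_deriveM hf hg)).
by rewrite addrC /GRing.scale/= [g p * _]mulrC.
Qed.

Lemma is_deriveD_fun f g p e df dg :
  is_derive p e f df -> is_derive p e g dg ->
  is_derive p e (fun x => f x + g x) (df + dg).
Proof. by move=> hf hg; exact: (is_deriveD hf hg). Qed.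

Lemma is_deriveN_fun f p e df :
  is_derive p e f df -> is_derive p e (fun x => - f x) (- df).
Proof. by move=> hf; exact: (is_deriveN hf). Qed.

Lemma is_derive_cst_fun (c : R) p e : is_derive p e (fun=> c) 0.
Proof. exact: is_derive_cst. Qed.

Lemma is_deriveX_fun f n p e df : is_derive p e f df ->
  is_derive p e (fun x => f x ^+ n.+1) (n.+1%:R * f p ^+ n * df).
Proof.
move=> hf; elim: n => [|n IH]; first by rewrite mulr1 mul1r.
have -> : (fun x => f x ^+ n.+2) = (fun x => f x * f x ^+ n.+1).
  by apply/funext => x; rewrite exprS.
apply: (is_derive_eq (is_deriveM_fun hf IH)).
by rewrite exprS [n.+2%:R]mulrSr; ring.
Qed.

End derivation_rules.

Section directional_calculus.
Context (R : realType).
Implicit Types (f g h : R * R -> R) (p e : R * R).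

Lemma is_derive_line f p e d :
  is_derive p e f d <-> is_derive (0 : R) 1 (fun s => f (s *: e + p)) d.
Proof.
have E : (fun h : R => h^-1 *: (f (h *: e + p) - f p)) =
    (fun h : R => h^-1 *: (f ((h *: 1 + 0) *: e + p) - f (0 *: e + p))).
  by apply/funext => h; rewrite addr0 scale0r add0r /GRing.scale /= mulr1.
split => -[df vf]; split.
- by rewrite /derivable -E.
- by rewrite /derive -E.
- by rewrite /derivable E.
- by rewrite /derive E.
Qed.

Lemma is_derive_comp_line (phi : R -> R) f p e d d' :
  is_derive p e f d -> is_derive (f p) 1 phi d' ->
  is_derive p e (fun x => phi (f x)) (d' * d).
Proof.
move=> /is_derive_line df dphi; apply/is_derive_line.
have fp : f p = f (0 *: e + p) by rewrite scale0r add0r.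
rewrite fp in dphi.
exact: (@is_derive1_comp _ phi (fun s => f (s *: e + p)) 0 _ _ dphi df).
Qed.

Lemma is_derive_fst p e : is_derive p e (fun x : R * R => x.1) e.1.
Proof.
apply/is_derive_line => /=.
have : is_derive (0 : R) 1 (fun s : R => s * e.1 + p.1) (1 * e.1 + 0).
  by apply: is_derive_eq; rewrite /GRing.scale/= ?mulr0 ?add0r ?mulr1 ?addr0 ?mul1r.
by rewrite mul1r addr0.
Qed.

Lemma is_derive_snd p e : is_derive p e (fun x : R * R => x.2) e.2.
Proof.
apply/is_derive_line => /=.
have : is_derive (0 : R) 1 (fun s : R => s * e.2 + p.2) (1 * e.2 + 0).
  by apply: is_derive_eq; rewrite /GRing.scale/= ?mulr0 ?add0r ?mulr1 ?addr0 ?mul1r.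
by rewrite mul1r addr0.
Qed.

Lemma is_derive_partial (a : 'I_2) f p : derivable f p (basis_vec R a) ->
  is_derive p (basis_vec R a) f (partial a f p).
Proof. by move=> df; split. Qed.

Lemma partial_val (a : 'I_2) f p d : is_derive p (basis_vec R a) f d ->
  partial a f p = d.
Proof. by move=> df; rewrite /partial derive_val. Qed.

End directional_calculus.

(** * Powers of the positive part *)

Section positive_part.
Context (R : realType).

Definition pos (s : R) : R := Num.max 0 s.

Lemma pos_ge0 s : 0 <= pos s. Proof. by rewrite /pos le_max lexx. Qed.

Lemma pos_gt0E s : 0 < s -> pos s = s.
Proof. by move=> s0; rewrite /pos max_r// ltW. Qed.

Lemma pos_le0E s : s <= 0 -> pos s = 0.
Proof. by move=> s0; rewrite /pos max_l. Qed.

Lemma continuous_pos : continuous pos.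
Proof.
by move=> s; apply: (@continuous_max _ _ (cst 0) id); [exact: cvg_cst|exact: cvg_id].
Qed.

(** The exponent is at least 2 because of the point 0: there the difference quotient is
    [pos h ^+ n.+1], which tends to 0. *)
Lemma is_derive_pos_exp n (s : R) :
  is_derive s 1 (fun x => pos x ^+ n.+2) (n.+2%:R * pos s ^+ n.+1).
Proof.
have [s0|s0|<-] := ltgtP 0 s.
- apply: (@near_eq_is_derive _ _ _ (fun x : R => x ^+ n.+2)).
    near=> x; rewrite pos_gt0E//; near: x; exact: lt_nbhsr.
  rewrite (pos_gt0E s0); apply: DeriveDef; first exact: exprn_derivable.
  by rewrite exp_derive /GRing.scale/= mulr1 mulr_natl.
- apply: (@near_eq_is_derive _ _ _ (fun _ : R => 0)).
    by near=> x; rewrite pos_le0E ?expr0n//; apply: ltW; near: x; exact: lt_nbhsl.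
  by rewrite (pos_le0E (ltW s0)) expr0n mulr0; exact: is_derive_cst.
- have posE x : pos x ^+ n.+2 = x * pos x ^+ n.+1.
    have [x0|x0] := leP x 0; first by rewrite pos_le0E// !expr0n mulr0.
    by rewrite pos_gt0E// exprS.
  rewrite pos_le0E// expr0n mulr0.
  have cvg0 : h^-1 *: (pos (h *: 1 + 0) ^+ n.+2 - pos 0 ^+ n.+2) @[h --> 0^'] --> (0 : R).
    have : pos h ^+ n.+1 @[h --> (0 : R)] --> pos 0 ^+ n.+1.
      by apply: (@continuous_comp _ _ _ pos (fun x => x ^+ n.+1));
        [exact: continuous_pos|exact: exprn_continuous].
    rewrite (pos_le0E (lexx 0)) expr0n => /cvg_within_filter cvgpos.
    move: (cvgpos (fun x => x != 0)).
    apply: cvg_trans; apply: near_eq_cvg; near=> h.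
    have h0 : h != 0 by near: h; exact: nbhs_dnbhs_neq.
    rewrite addr0 /GRing.scale/= mulr1 (posE h) expr0n subr0.
    by rewrite mulKf.
  split; first by apply/cvg_ex; exists 0.
  by apply/cvg_lim.
Unshelve. all: by end_near. Qed.

End positive_part.

Ltac is_derive_rules := repeat first
  [ exact: is_derive_cst_fun | exact: is_derive_fst | exact: is_derive_snd
  | eassumption
  | apply: is_deriveD_fun | apply: is_deriveN_fun | apply: is_deriveM_fun ].

Section continuity_at_a_point.
Context (R : realType).
Implicit Types (f g : R * R -> R) (p : R * R).

(** A named form of continuity at a point, on which [cts_rules] can match the shape of the
    function. *)
Definition cts p f : Prop := {for p, continuous f}.

Lemma ctsD p f g : cts p f -> cts p g -> cts p (fun x => f x + g x).
Proof. by move=> cf cg; apply: cvgD; [exact: cf|exact: cg]. Qed.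

Lemma ctsM p f g : cts p f -> cts p g -> cts p (fun x => f x * g x).
Proof. by move=> cf cg; apply: cvgM; [exact: cf|exact: cg]. Qed.

Lemma ctsN p f : cts p f -> cts p (fun x => - f x).
Proof. by move=> cf; apply: cvgN; exact: cf. Qed.

Lemma ctsX p f n : cts p f -> cts p (fun x => f x ^+ n).
Proof.
move=> cf.
by apply: (@continuous_comp _ _ _ f (fun x => x ^+ n)); [exact: cf|exact: exprn_continuous].
Qed.

Lemma cts_cst p (c : R) : cts p (fun=> c).
Proof. exact: cvg_cst. Qed.

End continuity_at_a_point.

Ltac atom_cts f := first
  [ match goal with H : cts _ ?h |- _ => constr_eq h f; exact H end
  | exact (@cts_cst _ _ _) ].

Ltac cts_rules := repeat lazymatch goal with
  | |- cts _ (fun x => @?f x + @?g x) => refine (@ctsD _ _ f g _ _)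
  | |- cts _ (fun x => @?f x * @?g x) => refine (@ctsM _ _ f g _ _)
  | |- cts _ (fun x => - @?f x) => refine (@ctsN _ _ f _)
  | |- cts _ (fun x => @?f x ^+ ?n) => refine (@ctsX _ _ f n _)
  | |- cts _ (fun x => ?f x) => atom_cts f
  | |- cts _ ?f => atom_cts f
  end.

Section real_bounds.
Context (R : realType).
Implicit Types x y X Y : R.

Lemma normM_le x y X Y : `|x| <= X -> `|y| <= Y -> `|x * y| <= X * Y.
Proof. by move=> xX yY; rewrite normrM ler_pM. Qed.

Lemma normD_le x y X Y : `|x| <= X -> `|y| <= Y -> `|x + y| <= X + Y.
Proof. by move=> xX yY; rewrite (le_trans (ler_normD _ _))// lerD. Qed.

Lemma normB_le x y X Y : `|x| <= X -> `|y| <= Y -> `|x - y| <= X + Y.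
Proof. by move=> xX yY; rewrite (le_trans (ler_normB _ _))// lerD. Qed.

Lemma is_derive_lipschitz (g dg : R -> R) (a b m : R) :
  (forall x, Num.min a b <= x <= Num.max a b ->
    is_derive x 1 g (dg x) /\ `|dg x| <= m) ->
  `|g a - g b| <= m * `|a - b|.
Proof.
wlog ab : a b / a <= b => [H|] dgm.
  have [/H|/ltW/H] := leP a b; first exact.
  by rewrite distrC [`|a - b|]distrC; apply; rewrite minC maxC.
move: dgm; rewrite min_l// max_r// => dgm.
have [||c] := @MVT_segment R g dg a b ab.
- by move=> x; rewrite in_itv/= => /andP[? ?]; apply: (dgm x _).1; rewrite !ltW.
- apply: derivable_within_continuous => x; rewrite in_itv/= => /dgm[dx _].
  exact: (@ex_derive _ _ _ _ _ _ _ dx).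
- rewrite in_itv/= => /dgm[_ cm]; rewrite distrC => ->.
  by rewrite normrM [`|b - a|]distrC ler_wpM2r.
Qed.

End real_bounds.

Section one_variable.
Context (R : realType).

(** [pos ^+ 2] is convex and its derivative [2 * pos] is 2-Lipschitz, so its first-order Taylor
    remainder lies between 0 and k^2. *)
Lemma pos_sq_taylor (y k : R) :
  0 <= pos (y + k) ^+ 2 - pos y ^+ 2 - 2 * k * pos y <= k ^+ 2.
Proof.
have [y0|y0] := leP y 0; have [yk0|yk0] := leP (y + k) 0;
  rewrite ?(pos_le0E y0) ?(pos_gt0E y0) ?(pos_le0E yk0) ?(pos_gt0E yk0);
  apply/andP; split; nra.
Qed.

(** Serves to differentiate an integral in a parameter: an explicit quadratic remainder takes the
    place of dominated convergence. *)
Lemma is_derive_quadratic_error (F : R -> R) (s L C d : R) : 0 < d -> 0 <= C ->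
  (forall h, `|h| < d -> `|F (s + h) - F s - h * L| <= C * h ^+ 2) ->
  is_derive s 1 F L.
Proof.
move=> d0 C0 FC.
have cv : h^-1 *: (F (h *: 1 + s) - F s) @[h --> 0^'] --> L.
  apply/cvgrPdist_le => e e0.
  have e'0 : 0 < e / (C + 1) by rewrite divr_gt0// ltr_wpDl.
  near=> h.
  have h0 : h != 0 by near: h; exact: nbhs_dnbhs_neq.
  have hd : `|h| < d by near: h; exact: dnbhs0_lt.
  have he : `|h| <= e / (C + 1) by near: h; exact: dnbhs0_le.
  rewrite distrC /GRing.scale/= mulr1 [h + s]addrC.
  rewrite -(@ler_pM2l _ `|h|) ?normr_gt0// -normrM mulrBr mulrA divff// mul1r.
  apply: (le_trans (FC _ hd)); rewrite -real_normK ?num_real// expr2 mulrCA.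
  rewrite ler_wpM2l//; move: he; rewrite ler_pdivlMr; last by rewrite ltr_wpDl.
  by rewrite mulrDr mulr1 mulrC; have := normr_ge0 h; lra.
by split; [apply/cvg_ex; exists L|exact/cvg_lim].
Unshelve. all: by end_near. Qed.

End one_variable.

(** * Coordinate boxes in the plane *)

Section coordinate_boxes.
Context (R : realType).
Implicit Types (p q : R * R) (r s : R).

Definition inbox q r p := `|p.1 - q.1| <= r /\ `|p.2 - q.2| <= r.

Lemma inbox_trans q p z r s : inbox q r p -> inbox p s z -> inbox q (r + s) z.
Proof.
move=> [p1 p2] [z1 z2]; split.
  by rewrite (_ : _ - _ = (p.1 - q.1) + (z.1 - p.1)); [exact: normD_le|ring].
by rewrite (_ : _ - _ = (p.2 - q.2) + (z.2 - p.2)); [exact: normD_le|ring].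
Qed.

Lemma inbox_sym q p r : inbox q r p -> inbox p r q.
Proof. by move=> [h1 h2]; split; rewrite distrC. Qed.

Lemma inbox_le q p r s : r <= s -> inbox q r p -> inbox q s p.
Proof. by move=> rs [h1 h2]; split; exact: le_trans rs. Qed.

Lemma inbox_refl q r : 0 <= r -> inbox q r q.
Proof. by move=> r0; split; rewrite subrr normr0. Qed.

Lemma near_inbox q (P : set (R * R)) : (\forall p \near q, P p) ->
  exists2 r, 0 < r & forall p, inbox q r p -> P p.
Proof.
move=> /nbhs_ballP[e /= e0 eP]; exists (e / 2); first by rewrite divr_gt0.
move=> p [h1 h2]; apply: eP; split; rewrite /ball/= distrC; lra.
Qed.

Lemma inbox_nbhs q r : 0 < r -> \forall p \near q, inbox q r p.
Proof.
move=> r0; apply/nbhs_ballP; exists r => //= p [].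
by rewrite /ball/= => h1 h2; split; rewrite distrC ltW.
Qed.

Lemma inboxP q r p :
  inbox q r p <-> (q.1 - r <= p.1 <= q.1 + r) /\ (q.2 - r <= p.2 <= q.2 + r).
Proof. by rewrite /inbox !ler_distl. Qed.

Lemma inbox_centered q r p : inbox q r p ->
  centered_box (`|q.1| + `|q.2| + r) p.
Proof.
move=> [h1 h2]; split; rewrite /= in_itv/= -ler_norml.
  rewrite (_ : p.1 = q.1 + (p.1 - q.1)); last by ring.
  by rewrite (le_trans (ler_normD _ _))//; have := normr_ge0 q.2; lra.
rewrite (_ : p.2 = q.2 + (p.2 - q.2)); last by ring.
by rewrite (le_trans (ler_normD _ _))//; have := normr_ge0 q.1; lra.
Qed.

End coordinate_boxes.

(** * Elliptic operators div (A grad) in the plane and Green's identity *)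

Section elliptic.
Context (R : realType).
Implicit Types (p q : R * R) (t d K : R) (f h v : R * R -> R).

Lemma Ck_continuous k Om h p : Ck k Om h -> Om p -> {for p, continuous h}.
Proof. by case: k => [|k] [ch _] /ch. Qed.

Lemma Ck_is_derive k Om h (a : 'I_2) p : Ck k.+1 Om h -> Om p ->
  is_derive p (basis_vec R a) h (partial a h p).
Proof. by move=> [_ /(_ a)[dh _]] Op; apply: is_derive_partial; exact: dh. Qed.

Lemma Ck_partial k Om h (a : 'I_2) : Ck k.+1 Om h -> Ck k Om (partial a h).
Proof. by move=> [_ /(_ a)[_]]. Qed.

Lemma fst_basis0 : (basis_vec R i0).1 = 1. Proof. by []. Qed.
Lemma snd_basis0 : (basis_vec R i0).2 = 0. Proof. by []. Qed.
Lemma fst_basis1 : (basis_vec R i1).1 = 0. Proof. by []. Qed.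
Lemma snd_basis1 : (basis_vec R i1).2 = 1. Proof. by []. Qed.

Lemma continuous_fst_plane : continuous (fun p => p.1).
Proof. by move=> p; exact: cvg_fst. Qed.
Lemma continuous_snd_plane : continuous (fun p => p.2).
Proof. by move=> p; exact: cvg_snd. Qed.

Context (Om : set (R * R)) (al be ga : R * R -> R).
Hypotheses (oOm : open Om) (al1 : Ck 1 Om al) (be1 : Ck 1 Om be)
  (ga1 : Ck 1 Om ga).

Definition flux0 v p := al p * partial i0 v p + be p * partial i1 v p.
Definition flux1 v p := be p * partial i0 v p + ga p * partial i1 v p.
Definition divA v p := partial i0 (flux0 v) p + partial i1 (flux1 v) p.

(* [quad q] is the quadratic form of A(q)^-1, where A is the matrix
   (al, be; be, ga): below det A = 1, so no division is needed.  [quadS] is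
   (A grad Q, grad Q) and [quadT] is div (A grad Q) for Q = [quad q]; near q
   they are 4 Q and 4 to leading order. *)
Definition ell0 q p := ga q * (p.1 - q.1) - be q * (p.2 - q.2).
Definition ell1 q p := al q * (p.2 - q.2) - be q * (p.1 - q.1).
Definition quad q p := (p.1 - q.1) * ell0 q p + (p.2 - q.2) * ell1 q p.

Definition bumpf n t q p := pos (t ^+ 2 - quad q p) ^+ n.

Definition quadS q p := 4 * (al p * ell0 q p ^+ 2
  + 2 * be p * (ell0 q p * ell1 q p) + ga p * ell1 q p ^+ 2).
Definition quadT q p := 2 * (partial i0 al p * ell0 q p + al p * ga q
  + partial i0 be p * ell1 q p - be p * be q
  + partial i1 be p * ell0 q p - be p * be q
  + partial i1 ga p * ell1 q p + ga p * al q).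

Lemma continuous_ell0 q : continuous (ell0 q).
Proof.
move=> p; apply: cvgB; apply: cvgM; try exact: cvg_cst.
  by apply: cvgB; [exact: continuous_fst_plane|exact: cvg_cst].
by apply: cvgB; [exact: continuous_snd_plane|exact: cvg_cst].
Qed.

Lemma continuous_ell1 q : continuous (ell1 q).
Proof.
move=> p; apply: cvgB; apply: cvgM; try exact: cvg_cst.
  by apply: cvgB; [exact: continuous_snd_plane|exact: cvg_cst].
by apply: cvgB; [exact: continuous_fst_plane|exact: cvg_cst].
Qed.

Lemma continuous_quad q : continuous (quad q).
Proof.
move=> p; apply: cvgD; apply: cvgM.
- by apply: cvgB; [exact: continuous_fst_plane|exact: cvg_cst].
- exact: continuous_ell0.
- by apply: cvgB; [exact: continuous_snd_plane|exact: cvg_cst].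
- exact: continuous_ell1.
Qed.

Lemma continuous_bump n t q : continuous (bumpf n t q).
Proof.
move=> p; rewrite /bumpf.
apply: (@continuous_comp _ _ _ (fun p => pos (t ^+ 2 - quad q p)) (fun x => x ^+ n)).
  apply: (@continuous_comp _ _ _ (fun p => t ^+ 2 - quad q p) (@pos R)).
    by apply: cvgB; [exact: cvg_cst|exact: continuous_quad].
  exact: continuous_pos.
exact: exprn_continuous.
Qed.

Lemma bumpf_out n t q p : t ^+ 2 <= quad q p -> bumpf n.+1 t q p = 0.
Proof. by move=> tq; rewrite /bumpf pos_le0E ?expr0n//; lra. Qed.

Lemma bumpf_ge0 n t q p : 0 <= bumpf n t q p.
Proof. by rewrite exprn_ge0// pos_ge0. Qed.

Definition ellipse_in t q N := forall p, quad q p <= t ^+ 2 ->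
  Om p /\ centered_box N p.

(* Since [bumpf] vanishes outside the ellipse, [h] need not be regular, or even
   meaningful, outside [Om]. *)
Lemma Cc_bumpf n t q N h : ellipse_in t q N ->
  (forall p, Om p -> {for p, continuous h}) ->
  Cc (fun p => h p * bumpf n.+1 t q p).
Proof.
move=> inO ch; split; last first.
  exists N => p pN; rewrite bumpf_out ?mulr0// leNgt; apply/negP => /ltW /inO[_].
  exact: pN.
move=> p; have [qt|tq] := leP (quad q p) (t ^+ 2).
  by apply: cvgM; [exact: ch (inO _ qt).1|exact: continuous_bump].
rewrite /continuous_at/= bumpf_out ?mulr0 ?ltW//.
have z : (fun=> 0 : R) x @[x --> p] --> (0 : R) by exact: cvg_cst.
apply: cvg_trans z.
apply: near_eq_cvg; near=> x; rewrite bumpf_out ?mulr0//; apply/ltW; near: x.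
exact: (@continuous_quad q p _ (lt_nbhsr tq)).
Unshelve. all: by end_near. Qed.

Lemma is_derive_ell0 q p e : is_derive p e (ell0 q) (ga q * e.1 - be q * e.2).
Proof. by rewrite /ell0; apply: is_derive_eq; is_derive_rules; rewrite /=; ring. Qed.

Lemma is_derive_ell1 q p e : is_derive p e (ell1 q) (al q * e.2 - be q * e.1).
Proof. by rewrite /ell1; apply: is_derive_eq; is_derive_rules; rewrite /=; ring. Qed.

Lemma is_derive_quad q p e :
  is_derive p e (quad q) (2 * (ell0 q p * e.1 + ell1 q p * e.2)).
Proof.
have d0 := is_derive_ell0 q p e; have d1 := is_derive_ell1 q p e.
rewrite /quad; apply: is_derive_eq; is_derive_rules.
by rewrite /= /ell0 /ell1; ring.
Qed.

Lemma is_derive_bumpf n t q p e : is_derive p e (bumpf n.+2 t q)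
  (n.+2%:R * bumpf n.+1 t q p * (- (2 * (ell0 q p * e.1 + ell1 q p * e.2)))).
Proof.
apply: (@is_derive_comp_line _ (fun x => pos x ^+ n.+2)
  (fun p => t ^+ 2 - quad q p)); last exact: is_derive_pos_exp.
have dq := is_derive_quad q p e.
by apply: is_derive_eq; is_derive_rules; rewrite add0r.
Qed.

(** The open sets [Om] and {t^2 < Q} cover the plane; on the second one the function is locally
    zero. *)
Lemma is_derive_glue t q N (f df : R * R -> R) e : ellipse_in t q N ->
  (forall p, Om p -> is_derive p e f (df p)) ->
  (forall p, t ^+ 2 < quad q p -> f p = 0 /\ df p = 0) ->
  forall p, is_derive p e f (df p).
Proof.
move=> inO dO out p; have [qt|tq] := leP (quad q p) (t ^+ 2).
  by apply: dO; exact: (inO _ qt).1.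
rewrite (out _ tq).2; apply: (@near_eq_is_derive _ _ _ (fun=> 0)).
  near=> x; rewrite (out x _).1//; near: x.
  exact: (@continuous_quad q p _ (lt_nbhsr tq)).
Unshelve. all: by end_near. Qed.

Lemma C1_intro h (dh : 'I_2 -> R * R -> R) :
  (forall p, Om p -> {for p, continuous h}) ->
  (forall a p, Om p -> is_derive p (basis_vec R a) h (dh a p)) ->
  (forall a p, Om p -> {for p, continuous (dh a)}) -> Ck 1 Om h.
Proof.
move=> ch dE cd; split => // a; split => [p Op|].
  by apply: (@ex_derive _ _ _ _ _ _ _ (dE a p Op)).
split => // p Op; rewrite /prop_for /continuous_at (partial_val (dE a p Op)).
apply: cvg_trans (cd a p Op); apply: near_eq_cvg; near=> x.
apply/esym/partial_val/dE; near: x; exact: (open_nbhs_nbhs (conj oOm Op)).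
Unshelve. all: by end_near. Qed.

Lemma C1M h v : Ck 1 Om h -> Ck 1 Om v -> Ck 1 Om (fun p => h p * v p).
Proof.
move=> h1 v1; apply: (@C1_intro _ (fun a p => partial a h p * v p + h p * partial a v p)).
- by move=> p Op; exact: ctsM (Ck_continuous h1 Op) (Ck_continuous v1 Op).
- by move=> a p Op; apply: is_deriveM_fun; exact: (@Ck_is_derive 0%N Om).
- move=> a p Op; have ch := Ck_continuous h1 Op; have cv := Ck_continuous v1 Op.
  have ch' := Ck_continuous (Ck_partial a h1) Op.
  have cv' := Ck_continuous (Ck_partial a v1) Op.
  exact: ctsD (ctsM ch' cv) (ctsM ch cv').
Qed.

Lemma C1D h v : Ck 1 Om h -> Ck 1 Om v -> Ck 1 Om (fun p => h p + v p).
Proof.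
move=> h1 v1; apply: (@C1_intro _ (fun a p => partial a h p + partial a v p)).
- by move=> p Op; exact: ctsD (Ck_continuous h1 Op) (Ck_continuous v1 Op).
- by move=> a p Op; apply: is_deriveD_fun; exact: (@Ck_is_derive 0%N Om).
- move=> a p Op; have ch' := Ck_continuous (Ck_partial a h1) Op.
  exact: ctsD ch' (Ck_continuous (Ck_partial a v1) Op).
Qed.

Lemma Ck_ext k f h : Ck k Om f -> (forall p, Om p -> f p = h p) -> Ck k Om h.
Proof.
elim: k f h => [|k IH] f h [cf df] fh.
  split => // p Op; rewrite /prop_for /continuous_at -(fh _ Op).
  apply: cvg_trans (cf _ Op); apply: near_eq_cvg.
  by apply: filterS (open_nbhs_nbhs (conj oOm Op)) => x /fh.
have near_fh p : Om p -> \forall x \near p, f x = h x.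
  by move=> Op; apply: filterS (open_nbhs_nbhs (conj oOm Op)) => x /fh.
split => [p Op|a].
  rewrite /prop_for /continuous_at -(fh _ Op).
  by apply: cvg_trans (cf _ Op); apply: near_eq_cvg; exact: near_fh.
have [dfa Ca] := df a.
have dh p : Om p -> is_derive p (basis_vec R a) h (partial a f p).
  move=> Op; apply: near_eq_is_derive (near_fh p Op) _.
  by apply: is_derive_partial; exact: dfa.
split => [p Op|]; first by apply: (@ex_derive _ _ _ _ _ _ _ (dh p Op)).
by apply: IH Ca _ => p Op; apply/esym/partial_val/dh.
Qed.

Lemma Ck_affine k f c d : Ck k Om f -> Ck k Om (fun p => c * f p + d).
Proof.
elim: k f d => [|k IH] f d [cf df].
  split => // p Op; apply: (@ctsD _ p (fun p => c * f p)); last exact: cts_cst.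
  by apply: ctsM; [exact: cts_cst|exact: cf].
split => [p Op|a].
  apply: (@ctsD _ p (fun p => c * f p)); last exact: cts_cst.
  by apply: ctsM; [exact: cts_cst|exact: cf].
have [dfa Ca] := df a.
have dh p : Om p -> is_derive p (basis_vec R a) (fun p => c * f p + d)
    (c * partial a f p + 0).
  move=> Op; apply: (is_derive_eq (is_deriveD_fun (is_deriveM_fun (is_derive_cst_fun c p _)
    (is_derive_partial (dfa p Op))) (is_derive_cst_fun d p _))).
  by rewrite mul0r add0r.
split => [p Op|]; first by apply: (@ex_derive _ _ _ _ _ _ _ (dh p Op)).
apply: Ck_ext (IH _ 0 Ca) _ => p Op.
by apply/esym/partial_val/dh.
Qed.

Lemma partial_affine k f c d a p : Ck k.+1 Om f -> Om p ->
  partial a (fun p => c * f p + d) p = c * partial a f p.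
Proof.
move=> fk Op; have df := Ck_is_derive a fk Op; apply: partial_val.
apply: (is_derive_eq (is_deriveD_fun (is_deriveM_fun (is_derive_cst_fun c p _) df)
  (is_derive_cst_fun d p _))).
by rewrite mul0r add0r addr0.
Qed.

Lemma C1_flux0 v : Ck 2 Om v -> Ck 1 Om (flux0 v).
Proof.
move=> v2.
exact: (C1D (C1M al1 (Ck_partial i0 v2)) (C1M be1 (Ck_partial i1 v2))).
Qed.

Lemma C1_flux1 v : Ck 2 Om v -> Ck 1 Om (flux1 v).
Proof.
move=> v2.
exact: (C1D (C1M be1 (Ck_partial i0 v2)) (C1M ga1 (Ck_partial i1 v2))).
Qed.

Lemma divA_affine v c d p : Ck 2 Om v -> Om p ->
  divA (fun p => c * v p + d) p = c * divA v p.
Proof.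
move=> v2 Op; rewrite /divA.
have near_Om := open_nbhs_nbhs (conj oOm Op).
have f0 := Ck_is_derive i0 (C1_flux0 v2) Op.
have f1 := Ck_is_derive i1 (C1_flux1 v2) Op.
have mul f df e : is_derive p e f df -> is_derive p e (fun x => c * f x) (c * df).
  move=> hf; apply: (is_derive_eq (is_deriveM_fun (is_derive_cst_fun c p e) hf)).
  by rewrite mul0r add0r.
rewrite mulrDr; congr (_ + _); apply: partial_val.
- apply: near_eq_is_derive (mul _ _ _ f0); apply: filterS near_Om => x Ox.
  by rewrite /flux0 !(partial_affine _ _ _ v2 Ox); ring.
- apply: near_eq_is_derive (mul _ _ _ f1); apply: filterS near_Om => x Ox.
  by rewrite /flux1 !(partial_affine _ _ _ v2 Ox); ring.
Qed.

Lemma continuous_divA v p : Ck 2 Om v -> Om p -> {for p, continuous (divA v)}.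
Proof.
move=> v2 Op; apply: cvgD.
  exact: Ck_continuous (Ck_partial i0 (C1_flux0 v2)) Op.
exact: Ck_continuous (Ck_partial i1 (C1_flux1 v2)) Op.
Qed.

Lemma cts_coefficients p : Om p -> [/\ cts p al, cts p be & cts p ga] /\
  forall a, [/\ cts p (partial a al), cts p (partial a be) & cts p (partial a ga)].
Proof.
move=> Op; have c k h : Ck k Om h -> cts p h by move=> /Ck_continuous; apply.
by split=> [|a]; split; apply: c; first [exact: al1|exact: be1|exact: ga1
  |exact: Ck_partial al1|exact: Ck_partial be1|exact: Ck_partial ga1].
Qed.

Lemma continuous_quadS q p : Om p -> cts p (quadS q).
Proof.
move=> /cts_coefficients[[? ? ?] _].
have ? : cts p (ell0 q) := @continuous_ell0 q p.
have ? : cts p (ell1 q) := @continuous_ell1 q p.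
by rewrite /quadS; cts_rules.
Qed.

Lemma continuous_quadT q p : Om p -> cts p (quadT q).
Proof.
move=> /cts_coefficients[[? ? ?] d]; have [? ? ?] := d i0; have [? ? ?] := d i1.
have ? : cts p (ell0 q) := @continuous_ell0 q p.
have ? : cts p (ell1 q) := @continuous_ell1 q p.
by rewrite /quadT; cts_rules.
Qed.

(** With w = (t^2 - Q)_+ this is the divergence theorem for the field w^3 A grad v - v A grad (w^3);
    the cross terms cancel since A is symmetric. The right-hand side is the integral of v div (A
    grad (w^3)), where div (A grad (w^3)) = 6 w (A grad Q, grad Q) - 3 w^2 div (A grad Q). *)
Lemma ibp_bumpf v t q N : Ck 2 Om v -> ellipse_in t q N ->
  pint (fun p => divA v p * bumpf 3 t q p) =
  pint (fun p => (6 * v p * quadS q p) * bumpf 1 t q p) -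
  pint (fun p => (3 * v p * quadT q p) * bumpf 2 t q p).
Proof.
move=> v2 inO.
have f01 := C1_flux0 v2; have f11 := C1_flux1 v2.
have v1 : Ck 1 Om v.
  case: (v2) => cv dv; split => // a; split; first exact: (dv a).1.
  by split => // p; exact: Ck_continuous (Ck_partial a v2).
(* (Z0, Z1) is A grad Q, because grad Q = 2 (ell0, ell1); [dZ0] and [dZ1] are the two terms of its
   divergence. *)
pose Z0 p := 2 * (al p * ell0 q p + be p * ell1 q p).
pose Z1 p := 2 * (be p * ell0 q p + ga p * ell1 q p).
pose dZ0 p := 2 * (partial i0 al p * ell0 q p + al p * ga q
  + (partial i0 be p * ell1 q p - be p * be q)).
pose dZ1 p := 2 * (partial i1 be p * ell0 q p - be p * be q
  + (partial i1 ga p * ell1 q p + ga p * al q)).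
pose X0 p := flux0 v p * bumpf 3 t q p + (3 * v p * Z0 p) * bumpf 2 t q p.
pose X1 p := flux1 v p * bumpf 3 t q p + (3 * v p * Z1 p) * bumpf 2 t q p.
pose dX0 p := partial i0 (flux0 v) p * bumpf 3 t q p
  + ((- 6 * flux0 v p * ell0 q p + 3 * (partial i0 v p * Z0 p + v p * dZ0 p))
      * bumpf 2 t q p
    + (- 12 * v p * Z0 p * ell0 q p) * bumpf 1 t q p).
pose dX1 p := partial i1 (flux1 v) p * bumpf 3 t q p
  + ((- 6 * flux1 v p * ell1 q p + 3 * (partial i1 v p * Z1 p + v p * dZ1 p))
      * bumpf 2 t q p
    + (- 12 * v p * Z1 p * ell1 q p) * bumpf 1 t q p).
have dX0E p : is_derive p (basis_vec R i0) X0 (dX0 p).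
  apply: (is_derive_glue inO) => {p} [p Op|p tq]; last first.
    by rewrite /X0 /dX0 !bumpf_out ?mulr0 ?addr0 ?ltW.
  have dal := Ck_is_derive i0 al1 Op; have dbe := Ck_is_derive i0 be1 Op.
  have dv := Ck_is_derive i0 v1 Op; have df := Ck_is_derive i0 f01 Op.
  have d0 := is_derive_ell0 q p (basis_vec R i0).
  have d1 := is_derive_ell1 q p (basis_vec R i0).
  have db3 := is_derive_bumpf 1 t q p (basis_vec R i0).
  have db2 := is_derive_bumpf 0 t q p (basis_vec R i0).
  rewrite /X0 /Z0; apply: is_derive_eq; is_derive_rules.
  by rewrite /dX0 /dZ0 /Z0 fst_basis0 snd_basis0 /GRing.scale/=; ring.
have dX1E p : is_derive p (basis_vec R i1) X1 (dX1 p).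
  apply: (is_derive_glue inO) => {p} [p Op|p tq]; last first.
    by rewrite /X1 /dX1 !bumpf_out ?mulr0 ?addr0 ?ltW.
  have dga := Ck_is_derive i1 ga1 Op; have dbe := Ck_is_derive i1 be1 Op.
  have dv := Ck_is_derive i1 v1 Op; have df := Ck_is_derive i1 f11 Op.
  have d0 := is_derive_ell0 q p (basis_vec R i1).
  have d1 := is_derive_ell1 q p (basis_vec R i1).
  have db3 := is_derive_bumpf 1 t q p (basis_vec R i1).
  have db2 := is_derive_bumpf 0 t q p (basis_vec R i1).
  rewrite /X1 /Z1; apply: is_derive_eq; is_derive_rules.
  by rewrite /dX1 /dZ1 /Z1 fst_basis1 snd_basis1 /GRing.scale/=; ring.
have ctsall p : Om p -> ([/\ cts p al, cts p be, cts p ga, cts p (ell0 q) &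
  cts p (ell1 q)] /\
   [/\ cts p v, cts p (flux0 v) & cts p (flux1 v)]) /\
   ([/\ cts p (partial i0 al), cts p (partial i0 be), cts p (partial i1 be) &
     cts p (partial i1 ga)] /\
   [/\ cts p (partial i0 v), cts p (partial i1 v), cts p (partial i0 (flux0 v)) &
     cts p (partial i1 (flux1 v))]).
  move=> Op; have [[c1 c2 c3] d] := cts_coefficients Op.
  have [c4 c5 _] := d i0; have [_ c6 c7] := d i1.
  exact (conj
    (conj (And5 c1 c2 c3 (@continuous_ell0 q p) (@continuous_ell1 q p))
      (And3 (Ck_continuous v1 Op) (Ck_continuous f01 Op) (Ck_continuous f11 Op)))
    (conj (And4 c4 c5 c6 c7)
      (And4 (Ck_continuous (Ck_partial i0 v1) Op) (Ck_continuous (Ck_partial i1 v1) Op)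
        (Ck_continuous (Ck_partial i0 f01) Op) (Ck_continuous (Ck_partial i1 f11) Op)))).
have cb n h : (forall p, Om p -> cts p h) -> Cc (fun p => h p * bumpf n.+1 t q p).
  by move=> ch; exact: (@Cc_bumpf n t q N h inO ch).
have cX0 : Cc X0.
  apply: CcD; [apply: (cb 2%N (flux0 v))|apply: (cb 1%N (fun p => 3 * v p * Z0 p))]
    => p /ctsall[[[? ? ? ? ?] [? ? ?]] [[? ? ? ?] [? ? ? ?]]];
  by rewrite /Z0; cts_rules.
have cX1 : Cc X1.
  apply: CcD; [apply: (cb 2%N (flux1 v))|apply: (cb 1%N (fun p => 3 * v p * Z1 p))]
    => p /ctsall[[[? ? ? ? ?] [? ? ?]] [[? ? ? ?] [? ? ? ?]]];
  by rewrite /Z1; cts_rules.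
have cdX0 : Cc dX0.
  (apply: CcD; [apply: (cb 2%N (partial i0 (flux0 v)))|apply: CcD;
   [apply: (cb 1%N (fun p => - 6 * flux0 v p * ell0 q p + 3 * (partial i0 v p * Z0 p +
     v p * dZ0 p)))
   |apply: (cb 0%N (fun p => - 12 * v p * Z0 p * ell0 q p))]]);
  move=> p /ctsall[[[? ? ? ? ?] [? ? ?]] [[? ? ? ?] [? ? ? ?]]];
  by rewrite /Z0 /dZ0; cts_rules.
have cdX1 : Cc dX1.
  (apply: CcD; [apply: (cb 2%N (partial i1 (flux1 v)))|apply: CcD;
   [apply: (cb 1%N (fun p => - 6 * flux1 v p * ell1 q p + 3 * (partial i1 v p * Z1 p +
     v p * dZ1 p)))
   |apply: (cb 0%N (fun p => - 12 * v p * Z1 p * ell1 q p))]]);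
  move=> p /ctsall[[[? ? ? ? ?] [? ? ?]] [[? ? ? ?] [? ? ? ?]]];
  by rewrite /Z1 /dZ1; cts_rules.
have int0 : pint dX0 = 0.
  have E : partial i0 X0 = dX0 by apply/funext => p; exact: partial_val.
  have d p : derivable X0 p (basis_vec R i0) := @ex_derive _ _ _ _ _ _ _ (dX0E p).
  by rewrite -E; apply: (pint_partial cX0 d); rewrite E.
have int1 : pint dX1 = 0.
  have E : partial i1 X1 = dX1 by apply/funext => p; exact: partial_val.
  have d p : derivable X1 p (basis_vec R i1) := @ex_derive _ _ _ _ _ _ _ (dX1E p).
  by rewrite -E; apply: (pint_partial cX1 d); rewrite E.
have cL : Cc (fun p => divA v p * bumpf 3 t q p).
  by apply: (cb 2%N (divA v)) => p Op; exact: continuous_divA.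
have cS : Cc (fun p => (6 * v p * quadS q p) * bumpf 1 t q p).
  apply: (cb 0%N (fun p => 6 * v p * quadS q p)) => p Op.
  have ? := @continuous_quadS q _ Op; have [[_ [? _ _]] _] := ctsall _ Op.
  by cts_rules.
have cT : Cc (fun p => (3 * v p * quadT q p) * bumpf 2 t q p).
  apply: (cb 1%N (fun p => 3 * v p * quadT q p)) => p Op.
  have ? := @continuous_quadT q _ Op; have [[_ [? _ _]] _] := ctsall _ Op.
  by cts_rules.
have : pint (fun p => dX0 p + dX1 p) = 0 by rewrite pintD// int0 int1 addr0.
have -> : (fun p => dX0 p + dX1 p) = (fun p => divA v p * bumpf 3 t q p +
   ((- 1) * ((6 * v p * quadS q p) * bumpf 1 t q p) +
   (3 * v p * quadT q p) * bumpf 2 t q p)).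
  apply/funext => p; rewrite /dX0 /dX1 /divA /quadS /quadT /Z0 /Z1 /dZ0 /dZ1.
  by rewrite /flux0 /flux1 /=; ring.
rewrite pintD//; last by apply: CcD => //; exact: CcZ.
by rewrite pintD ?pintZ//; [lra|exact: CcZ].
Qed.

(** * Comparison with the coefficients frozen at the centre of an ellipse *)

Hypotheses (det1 : forall p, Om p -> al p * ga p - be p ^+ 2 = 1)
  (al_gt0 : forall p, Om p -> 0 < al p).

(** All later constants depend on the coefficients through [r] and [m] only. The condition 1 <= m
    lets lower powers of m be absorbed by higher ones. *)
Definition tame x0 r m := [/\ 0 < r, 1 <= m & forall p, inbox x0 r p ->
  [/\ Om p, `|al p| <= m, `|be p| <= m & `|ga p| <= m] /\
  forall a, [/\ `|partial a al p| <= m, `|partial a be p| <= m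
    & `|partial a ga p| <= m]].

Lemma near_bounded x0 h : {for x0, continuous h} ->
  \forall p \near x0, `|h p| <= `|h x0| + 1.
Proof.
move=> /cvg_ball/(_ 1 ltr01); apply: filterS => p.
rewrite /ball/= => hp; rewrite (_ : h p = h x0 - (h x0 - h p)); last by ring.
by rewrite (le_trans (ler_normB _ _))// lerD2l ltW.
Qed.

Lemma C1_near_bounded x0 h : Ck 1 Om h -> Om x0 -> exists2 c, 1 <= c &
  \forall p \near x0, `|h p| <= c /\ forall a, `|partial a h p| <= c.
Proof.
move=> h1 Ox0.
have n1 := near_bounded (Ck_continuous h1 Ox0).
have n2 := near_bounded (Ck_continuous (Ck_partial i0 h1) Ox0).
have n3 := near_bounded (Ck_continuous (Ck_partial i1 h1) Ox0).
have sum (x y z : R) : [/\ 1 <= `|x| + 1 + (`|y| + 1) + (`|z| + 1),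
   `|x| + 1 <= `|x| + 1 + (`|y| + 1) + (`|z| + 1),
   `|y| + 1 <= `|x| + 1 + (`|y| + 1) + (`|z| + 1) &
   `|z| + 1 <= `|x| + 1 + (`|y| + 1) + (`|z| + 1)].
  by have := normr_ge0 x; have := normr_ge0 y; have := normr_ge0 z; split; lra.
have [s1 s2 s3 s4] := sum (h x0) (partial i0 h x0) (partial i1 h x0).
exists (`|h x0| + 1 + (`|partial i0 h x0| + 1) + (`|partial i1 h x0| + 1)); first exact: s1.
apply: filter_app n3; apply: filter_app n2; apply: filterS n1 => p b1 b2 b3.
split; first exact: le_trans b1 s2.
by move=> a; have [->|->] := ord2_cases a; [exact: le_trans b2 s3|exact: le_trans b3 s4].
Qed.

Lemma tame_exists x0 : Om x0 -> exists r m, tame x0 r m.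
Proof.
move=> Ox0.
have [ca ca1 na] := C1_near_bounded al1 Ox0.
have [cb cb1 nb] := C1_near_bounded be1 Ox0.
have [cc cc1 nc] := C1_near_bounded ga1 Ox0.
have nO : \forall p \near x0, Om p := open_nbhs_nbhs (conj oOm Ox0).
have ma : ca <= ca + cb + cc by lra.
have mb : cb <= ca + cb + cc by lra.
have mc : cc <= ca + cb + cc by lra.
have [r r0 H] : exists2 r, 0 < r & forall p, inbox x0 r p ->
  [/\ Om p, `|al p| <= ca /\ (forall a, `|partial a al p| <= ca),
    `|be p| <= cb /\ (forall a, `|partial a be p| <= cb)
    & `|ga p| <= cc /\ (forall a, `|partial a ga p| <= cc)].
  apply: near_inbox; apply: filter_app na; apply: filter_app nb.
  apply: filter_app nc; apply: filterS nO => p h1 h2 h3 h4.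
  exact: And4 h1 h4 h3 h2.
exists r, (ca + cb + cc); split; [exact: r0|exact: le_trans ca1 ma|].
move=> p /H[Op [h1 h2] [h3 h4] [h5 h6]]; split.
  exact: And4 Op (le_trans h1 ma) (le_trans h3 mb) (le_trans h5 mc).
by move=> a; exact: And3 (le_trans (h2 a) ma) (le_trans (h4 a) mb) (le_trans (h6 a) mc).
Qed.

Context (x0 : R * R) (r m : R) (tm : tame x0 r m).

Let r0 : 0 < r. Proof. by case: tm. Qed.
Let m1 : 1 <= m. Proof. by case: tm. Qed.
Let m0 : 0 < m. Proof. exact: lt_le_trans ltr01 m1. Qed.
Let tmO p : inbox x0 r p -> Om p. Proof. by case: tm => _ _ /(_ p) H /H[[]]. Qed.

Lemma tame_lipschitz h p q d : Ck 1 Om h ->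
  (forall a p, inbox x0 r p -> `|partial a h p| <= m) ->
  inbox x0 r p -> inbox x0 r q -> inbox q d p -> `|h p - h q| <= 2 * m * d.
Proof.
move=> h1 hm [p1 p2] [q1 q2] [d1 d2].
(* Moving along the two axes through the corner (q.1, p.2) stays inside the box, so that bounds on
   partial derivatives are enough. *)
have -> : h p - h q = (h (p.1, p.2) - h (q.1, p.2)) + (h (q.1, p.2) - h (q.1, q.2)).
  by case: p {p1 p2 d1 d2} => *; case: q {q1 q2} => *; ring.
have conv (a b c x : R) : `|a - c| <= r -> `|b - c| <= r ->
    Num.min a b <= x <= Num.max a b -> `|x - c| <= r.
  rewrite !ler_distl => /andP[? ?] /andP[? ?]; rewrite ge_min le_max.
  move=> /andP[/orP[?|?] /orP[?|?]]; apply/andP; split; lra.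
rewrite (_ : 2 * m * d = m * d + m * d); last by ring.
apply: normD_le.
- apply: le_trans (_ : m * `|p.1 - q.1| <= _); last by rewrite ler_pM2l.
  apply: (@is_derive_lipschitz _ (fun s => h (s, p.2))
    (fun s => partial i0 h (s, p.2))) => s ss.
  have sb : inbox x0 r (s, p.2) by split => //=; exact: conv ss.
  split; last exact: hm.
  have := Ck_is_derive i0 h1 (tmO sb) => -[/is_derive_slice + _].
  by rewrite eqxx.
- apply: le_trans (_ : m * `|p.2 - q.2| <= _); last by rewrite ler_pM2l.
  apply: (@is_derive_lipschitz _ (fun s => h (q.1, s))
    (fun s => partial i1 h (q.1, s))) => s ss.
  have sb : inbox x0 r (q.1, s) by split => //=; exact: conv ss.
  split; last exact: hm.
  by have := Ck_is_derive i1 h1 (tmO sb) => -[/is_derive_slice + _].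
Qed.

Let al_m p : inbox x0 r p -> `|al p| <= m.
Proof. by case: tm => _ _ /(_ p) H /H[[]]. Qed.
Let be_m p : inbox x0 r p -> `|be p| <= m.
Proof. by case: tm => _ _ /(_ p) H /H[[]]. Qed.
Let ga_m p : inbox x0 r p -> `|ga p| <= m.
Proof. by case: tm => _ _ /(_ p) H /H[[]]. Qed.
Let dal_m a p : inbox x0 r p -> `|partial a al p| <= m.
Proof. by case: tm => _ _ /(_ p) H /H[_ /(_ a)[]]. Qed.
Let dbe_m a p : inbox x0 r p -> `|partial a be p| <= m.
Proof. by case: tm => _ _ /(_ p) H /H[_ /(_ a)[]]. Qed.
Let dga_m a p : inbox x0 r p -> `|partial a ga p| <= m.
Proof. by case: tm => _ _ /(_ p) H /H[_ /(_ a)[]]. Qed.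

(** Completing the square: al Q = ell1^2 + (det A) (p.1 - q.1)^2, with det A = 1. *)
Lemma fst_sq_le_quad q p : Om q -> (p.1 - q.1) ^+ 2 <= al q * quad q p.
Proof.
move=> Oq; have dq := det1 Oq; rewrite -subr_ge0.
rewrite (_ : _ - _ = ell1 q p ^+ 2 + (p.1 - q.1) ^+ 2 * ((al q * ga q - be q ^+ 2) - 1)).
  by rewrite dq subrr mulr0 addr0 sqr_ge0.
by rewrite /quad /ell1 /ell0; ring.
Qed.

Lemma snd_sq_le_quad q p : Om q -> (p.2 - q.2) ^+ 2 <= ga q * quad q p.
Proof.
move=> Oq; have dq := det1 Oq; rewrite -subr_ge0.
rewrite (_ : _ - _ = ell0 q p ^+ 2 + (p.2 - q.2) ^+ 2 * ((al q * ga q - be q ^+ 2) - 1)).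
  by rewrite dq subrr mulr0 addr0 sqr_ge0.
by rewrite /quad /ell1 /ell0; ring.
Qed.

Lemma quad_ge0 q p : Om q -> 0 <= quad q p.
Proof.
move=> Oq; have := le_trans (sqr_ge0 _) (fst_sq_le_quad p Oq).
by rewrite pmulr_rge0// al_gt0.
Qed.

Lemma ellipse_inbox q p t : inbox x0 r q -> 0 <= t -> quad q p <= t ^+ 2 ->
  inbox q (m * t) p.
Proof.
move=> xq t0 Qt; have Oq := tmO xq; have Q0 := quad_ge0 p Oq.
have bound (c y : R) : `|c| <= m -> y ^+ 2 <= c * quad q p -> `|y| <= m * t.
  move=> cm ycQ; have mt0 : 0 <= m * t by rewrite mulr_ge0// ltW.
  rewrite -(@ler_pXn2r _ 2%N) ?nnegrE//= real_normK ?num_real//.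
  apply: (le_trans ycQ).
  apply: (le_trans (ler_wpM2r Q0 (le_trans (ler_norm _) cm))).
  apply: (le_trans (ler_wpM2l (ltW m0) Qt)); rewrite exprMn ler_wpM2r ?sqr_ge0//.
  by rewrite expr2 ler_pMl.
split; first exact: bound (al_m xq) (fst_sq_le_quad p Oq).
exact: bound (ga_m xq) (snd_sq_le_quad p Oq).
Qed.

Definition boxN : R := `|x0.1| + `|x0.2| + r.

Lemma tame_ellipse_in q t : inbox x0 (r / 2) q -> 0 <= t -> m * t <= r / 2 ->
  ellipse_in t q boxN.
Proof.
move=> xq t0 tr p Qt.
have xrq : inbox x0 r q by apply: inbox_le xq; have := r0; lra.
have pq := ellipse_inbox xrq t0 Qt.
have xr : inbox x0 r p by apply: inbox_le (inbox_trans xq pq); lra.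
by split; [exact: tmO|exact: inbox_centered].
Qed.

Lemma ell_bound q p d : inbox x0 r q -> inbox q d p ->
  `|ell0 q p| <= 2 * m * d /\ `|ell1 q p| <= 2 * m * d.
Proof.
move=> xq [d1 d2]; rewrite (_ : 2 * m * d = m * d + m * d); last by ring.
split; apply: normB_le; apply: normM_le => //.
- exact: ga_m.
- exact: be_m.
- exact: al_m.
- exact: be_m.
Qed.

Lemma quad_bound q p d : inbox x0 r q -> inbox q d p ->
  quad q p <= 4 * m * d ^+ 2.
Proof.
move=> xq qp; have [e0 e1] := ell_bound xq qp; case: (qp) => d1 d2.
apply: (le_trans (ler_norm _)).
rewrite (_ : 4 * m * d ^+ 2 = d * (2 * m * d) + d * (2 * m * d)); last by ring.
by apply: normD_le; apply: normM_le.
Qed.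

(** With coefficients frozen at q, [quadS] is exactly 4 Q, since (ell0, ell1) = A(q)^-1 (p - q).
    Each error term has one Lipschitz factor 2 m d and two factors [ell], also at most 2 m d; the
    weights 4, 8, 4 give 16 * 8 = 128. *)
Lemma quadS_bound q p d : inbox x0 r q -> inbox x0 r p -> inbox q d p ->
  `|quadS q p - 4 * quad q p| <= 128 * m ^+ 3 * d ^+ 3.
Proof.
move=> xq xp qp; have [e0 e1] := ell_bound xq qp; have dq := det1 (tmO xq).
have la := tame_lipschitz al1 (fun a p => @dal_m a p) xp xq qp.
have lb := tame_lipschitz be1 (fun a p => @dbe_m a p) xp xq qp.
have lg := tame_lipschitz ga1 (fun a p => @dga_m a p) xp xq qp.
have -> : quadS q p - 4 * quad q p =
  (4 * (al p - al q)) * (ell0 q p * ell0 q p) +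
  (8 * (be p - be q)) * (ell0 q p * ell1 q p) +
  (4 * (ga p - ga q)) * (ell1 q p * ell1 q p).
  apply/eqP; rewrite -subr_eq0; apply/eqP.
  rewrite (_ : _ - _ = 4 * quad q p * ((al q * ga q - be q ^+ 2) - 1)).
    by rewrite dq subrr mulr0.
  by rewrite /quadS /quad /ell0 /ell1; ring.
rewrite (_ : 128 * _ * _ = (4 * (2 * m * d)) * ((2 * m * d) * (2 * m * d))
  + (8 * (2 * m * d)) * ((2 * m * d) * (2 * m * d))
  + (4 * (2 * m * d)) * ((2 * m * d) * (2 * m * d))); last by ring.
apply: normD_le; [apply: normD_le|]; (apply: normM_le; last exact: normM_le);
  by apply: normM_le => //; rewrite ger0_norm.
Qed.

(** Frozen at q, the terms without derivatives of the coefficients add up to 4 det A = 4; eight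
    errors of size 2 m^2 d remain, with a common factor 2. *)
Lemma quadT_bound q p d : inbox x0 r q -> inbox x0 r p -> inbox q d p ->
  `|quadT q p - 4| <= 32 * m ^+ 2 * d.
Proof.
move=> xq xp qp; have [e0 e1] := ell_bound xq qp; have dq := det1 (tmO xq).
have la := tame_lipschitz al1 (fun a p => @dal_m a p) xp xq qp.
have lb := tame_lipschitz be1 (fun a p => @dbe_m a p) xp xq qp.
have lg := tame_lipschitz ga1 (fun a p => @dga_m a p) xp xq qp.
have -> : quadT q p - 4 =
  2 * (partial i0 al p * ell0 q p + partial i0 be p * ell1 q p
     + partial i1 be p * ell0 q p + partial i1 ga p * ell1 q p
     + (al p - al q) * ga q - (be p - be q) * be q
     - (be p - be q) * be q + (ga p - ga q) * al q).
  apply/eqP; rewrite -subr_eq0; apply/eqP.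
  rewrite (_ : _ - _ = 4 * ((al q * ga q - be q ^+ 2) - 1)).
    by rewrite dq subrr mulr0.
  by rewrite /quadT; ring.
rewrite (_ : 32 * m ^+ 2 * d = 2 * (m * (2 * m * d) + m * (2 * m * d) +
  m * (2 * m * d) + m * (2 * m * d) + (2 * m * d) * m + (2 * m * d) * m +
  (2 * m * d) * m + (2 * m * d) * m)); last by ring.
apply: normM_le; first by rewrite ger0_norm.
apply: normD_le; last by apply: normM_le => //; try exact: al_m.
apply: normB_le; last by apply: normM_le => //; try exact: be_m.
apply: normB_le; last by apply: normM_le => //; try exact: be_m.
apply: normD_le; last by apply: normM_le => //; try exact: ga_m.
apply: normD_le; last by apply: normM_le => //; try exact: dga_m.
apply: normD_le; last by apply: normM_le => //; try exact: dbe_m.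
apply: normD_le; last by apply: normM_le => //; try exact: dbe_m.
by apply: normM_le => //; try exact: dal_m.
Qed.

(** On the ellipse of scale t one may take d = m t in [quadS_bound] and [quadT_bound]; in
    [bump_inequality] the errors add up to 6 * 128 + 3 * 32 = 864, rounded up. *)
Definition errC := 900 * m ^+ 6.

(** For S = 4 Q and T = 4 the right-hand side is 24 Q w - 12 w^2, and Q = t^2 - w turns it into 24
    t^2 w - 36 w^2. The deviation of T is multiplied by w^2, and w <= t^2 brings it to the order t^3
    w of the other error. *)
Lemma bump_inequality (S Q T t w : R) : 0 <= t -> 0 <= Q -> 0 <= w ->
  w = t ^+ 2 - Q ->
  `|S - 4 * Q| <= 128 * m ^+ 6 * t ^+ 3 -> `|T - 4| <= 32 * m ^+ 3 * t ->
  (24 * t ^+ 2 - errC * t ^+ 3) * w - 36 * w ^+ 2 <= 6 * S * w - 3 * T * w ^+ 2.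
Proof.
move=> t0 Q0 w0 wE; rewrite !ler_distl => /andP[S1 _] /andP[_ T1].
have m36 : m ^+ 3 <= m ^+ 6 by rewrite ler_weXn2l.
have wt : w <= t ^+ 2 by lra.
have t3 : 0 <= t ^+ 3 by rewrite exprn_ge0.
have E1 : 6 * (4 * Q - 128 * m ^+ 6 * t ^+ 3) * w <= 6 * S * w by rewrite ler_wpM2r//; lra.
have E2 : 3 * T * w ^+ 2 <= 3 * (4 + 32 * m ^+ 3 * t) * w ^+ 2.
  by rewrite ler_wpM2r ?sqr_ge0//; lra.
have E3 : 96 * m ^+ 3 * t * w ^+ 2 <= 96 * m ^+ 6 * t ^+ 3 * w.
  rewrite (_ : 96 * m ^+ 3 * t * w ^+ 2 = (96 * t * w) * (m ^+ 3 * w)); last by ring.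
  rewrite (_ : 96 * m ^+ 6 * t ^+ 3 * w = (96 * t * w) * (m ^+ 6 * t ^+ 2)); last by ring.
  by rewrite ler_wpM2l ?mulr_ge0// ler_pM// exprn_ge0// ltW.
have E4 : 864 * m ^+ 6 * t ^+ 3 * w <= errC * t ^+ 3 * w.
  by rewrite /errC !ler_wpM2r//; have := exprn_gt0 6 m0; lra.
have -> : 36 * w ^+ 2 = 12 * w ^+ 2 + 24 * (t ^+ 2 - Q) * w by rewrite -wE; ring.
nra.
Qed.

Lemma Cc_tame n t q h : inbox x0 (r / 2) q -> 0 <= t -> m * t <= r / 2 ->
  (forall p, Om p -> cts p h) -> Cc (fun p => h p * bumpf n.+1 t q p).
Proof.
by move=> xq t0 tr ch; exact: (@Cc_bumpf n t q _ h (tame_ellipse_in xq t0 tr) ch).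
Qed.

Lemma Cc_bump_tame n t q : inbox x0 (r / 2) q -> 0 <= t -> m * t <= r / 2 ->
  Cc (bumpf n.+1 t q).
Proof.
move=> xq t0 tr; have -> : bumpf n.+1 t q = fun p => 1 * bumpf n.+1 t q p.
  by apply/funext => p; rewrite mul1r.
by apply: (@Cc_tame n t q (fun=> 1)) => // p _; exact: cts_cst.
Qed.

Lemma half_r q : inbox x0 (r / 2) q -> inbox x0 r q.
Proof. by move=> xq; apply: inbox_le xq; have := r0; lra. Qed.

Lemma C2_cts v : Ck 2 Om v -> forall p, Om p -> cts p v.
Proof. by move=> v2 p Op; exact: Ck_continuous v2 Op. Qed.

(* Green's identity [ibp_bumpf] with the leading order values of [quadS] and
   [quadT] inserted. *)
Lemma key_inequality v t q : Ck 2 Om v -> (forall p, Om p -> 0 <= v p) ->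
  inbox x0 (r / 2) q -> 0 <= t -> m * t <= r / 2 ->
  (24 * t ^+ 2 - errC * t ^+ 3) * pint (fun p => v p * bumpf 1 t q p)
  - 36 * pint (fun p => v p * bumpf 2 t q p)
  <= pint (fun p => divA v p * bumpf 3 t q p).
Proof.
move=> v2 v0 xq t0 tr; have inO := tame_ellipse_in xq t0 tr.
rewrite (ibp_bumpf v2 inO).
have cv := C2_cts v2.
have cS : Cc (fun p => (6 * v p * quadS q p) * bumpf 1 t q p).
  apply: (@Cc_tame 0 t q (fun p => 6 * v p * quadS q p)) => // p Op.
  have ? := cv _ Op; have ? := @continuous_quadS q _ Op.
  by cts_rules.
have cT : Cc (fun p => (3 * v p * quadT q p) * bumpf 2 t q p).
  apply: (@Cc_tame 1 t q (fun p => 3 * v p * quadT q p)) => // p Op.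
  have ? := cv _ Op; have ? := @continuous_quadT q _ Op.
  by cts_rules.
have c1 : Cc (fun p => v p * bumpf 1 t q p) by exact: Cc_tame.
have c2 : Cc (fun p => v p * bumpf 2 t q p) by exact: Cc_tame.
set A := 24 * t ^+ 2 - errC * t ^+ 3.
have -> : A * pint (fun p => v p * bumpf 1 t q p)
    - 36 * pint (fun p => v p * bumpf 2 t q p) =
  pint (fun p => A * (v p * bumpf 1 t q p) + (- 36) * (v p * bumpf 2 t q p)).
  by rewrite pintD; [rewrite !pintZ// mulNr|exact: CcZ|exact: CcZ].
have -> : pint (fun p => 6 * v p * quadS q p * bumpf 1 t q p)
    - pint (fun p => 3 * v p * quadT q p * bumpf 2 t q p) =
  pint (fun p => 6 * v p * quadS q p * bumpf 1 t q p +
    (- 1) * (3 * v p * quadT q p * bumpf 2 t q p)).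
  by rewrite pintD; [rewrite pintZ// mulN1r|exact: cS|exact: CcZ].
apply: le_pint => [||p]; [by apply: CcD; exact: CcZ|by apply: CcD => //; exact: CcZ|].
have [Qt|tQ] := ltP (quad q p) (t ^+ 2); last first.
  by rewrite !bumpf_out// !mulr0 !addr0.
have xrq := half_r xq; have Op := (inO p (ltW Qt)).1.
have qp := ellipse_inbox xrq t0 (ltW Qt).
have xp : inbox x0 r p by apply: inbox_le (inbox_trans xq qp); lra.
have wE : pos (t ^+ 2 - quad q p) = t ^+ 2 - quad q p by rewrite pos_gt0E// subr_gt0.
have bS : `|quadS q p - 4 * quad q p| <= 128 * m ^+ 6 * t ^+ 3.
  by have := quadS_bound xrq xp qp; rewrite exprMn mulrA -[128 * _ * _]mulrA -exprD.
have bT : `|quadT q p - 4| <= 32 * m ^+ 3 * t.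
  by have := quadT_bound xrq xp qp; rewrite mulrA -[32 * _ * _]mulrA -exprSr.
have := bump_inequality t0 (quad_ge0 p (tmO xrq)) (pos_ge0 _) wE bS bT.
rewrite -/A => H; have {H} := ler_wpM2l (v0 _ Op) H.
rewrite /bumpf; set w := pos _; rewrite expr1.
rewrite (_ : v p * (A * w - 36 * w ^+ 2) = A * (v p * w) + -36 * (v p * w ^+ 2));
  last by ring.
by rewrite (_ : v p * (6 * _ * w - _) =
  6 * v p * quadS q p * w + -1 * (3 * v p * quadT q p * w ^+ 2)); last by ring.
Qed.

(** * Means over ellipses and the weak Harnack inequality *)

Definition mean2 v q t := pint (fun p => v p * bumpf 2 t q p).

Lemma bump_ge0v n v t q : (forall p, Om p -> 0 <= v p) -> ellipse_in t q boxN ->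
  forall p, 0 <= v p * bumpf n.+1 t q p.
Proof.
move=> v0 inO p; have [Qt|tQ] := leP (quad q p) (t ^+ 2).
  by rewrite mulr_ge0 ?bumpf_ge0//; apply: v0; exact: (inO _ Qt).1.
by rewrite bumpf_out ?mulr0// ltW.
Qed.

(** Integrates [pos_sq_taylor] with increment k = (t + h)^2 - t^2. The larger scale t1 supplies a
    fixed compactly supported majorant of the remainder for all small h. *)
Lemma is_derive_mean2 v q t t1 : Ck 2 Om v -> (forall p, Om p -> 0 <= v p) ->
  inbox x0 (r / 2) q -> 0 < t -> t < t1 -> m * t1 <= r / 2 ->
  is_derive t 1 (mean2 v q) (4 * t * pint (fun p => v p * bumpf 1 t q p)).
Proof.
move=> v2 v0 xq t0 tt1 tr.
have inO s : 0 <= s -> s <= t1 -> ellipse_in s q boxN.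
  move=> s0 s1; apply: tame_ellipse_in => //.
  by apply: le_trans tr; rewrite ler_pM2l.
have Ccv n s : 0 <= s -> s <= t1 -> Cc (fun p => v p * bumpf n.+1 s q p).
  move=> s0 s1; apply: Cc_tame => //; last exact: C2_cts.
  by apply: le_trans tr; rewrite ler_pM2l.
pose t' := (t + t1) / 2; pose c := t1 ^+ 2 - t' ^+ 2.
have c0 : 0 < c by rewrite /c /t' subr_gt0 ltr_pXn2r ?nnegrE//; lra.
pose I1 s := pint (fun p => v p * bumpf 1 s q p).
have I0 s : 0 <= s -> s <= t1 -> 0 <= I1 s.
  move=> s0 s1; apply: Rintegral_ge0 => p _.
  by apply: (@bump_ge0v 0) => //; exact: inO.
pose C := (t + t1) ^+ 2 / c * I1 t1 + 2 * I1 t.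
have C0 : 0 <= C.
  by rewrite addr_ge0 ?mulr_ge0 ?sqr_ge0 ?invr_ge0 ?I0//; lra.
apply: (@is_derive_quadratic_error _ _ _ _ C (Num.min t ((t1 - t) / 2))) => //.
  by rewrite lt_min t0; lra.
move=> h; rewrite lt_min => /andP[ht ht1].
have [hl hr] : - t < h /\ h < (t1 - t) / 2.
  by move: ht ht1; rewrite !ltr_norml => /andP[? ?] /andP[? ?].
pose k := 2 * t * h + h ^+ 2.
have th0 : 0 <= t + h by lra.
have tht1 : t + h <= t1 by lra.
have t00 := ltW t0; have tt1' := ltW tt1; have t10 : 0 <= t1 by lra.
pose D p := v p * bumpf 2 (t + h) q p + ((- 1) * (v p * bumpf 2 t q p)
  + (- (2 * k)) * (v p * bumpf 1 t q p)).
have c1 := Ccv 1%N _ th0 tht1; have c2 := Ccv 1%N _ t00 tt1'.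
have c3 := Ccv 0%N _ t00 tt1'; have c4 := Ccv 0%N _ t10 (lexx t1).
have cD : Cc D := CcD c1 (CcD (CcZ _ c2) (CcZ _ c3)).
have DE : pint D = mean2 v q (t + h) - mean2 v q t - 2 * k * I1 t.
  rewrite /D (pintD c1 (CcD (CcZ _ c2) (CcZ _ c3))) (pintD (CcZ _ c2) (CcZ _ c3)).
  by rewrite (pintZ _ c2) (pintZ _ c3) /mean2 /I1; ring.
have Dp p : 0 <= D p <= k ^+ 2 / c * (v p * bumpf 1 t1 q p).
  have [Qt|tQ] := leP (quad q p) (t1 ^+ 2); last first.
    have out n s : 0 <= s -> s <= t1 -> bumpf n.+1 s q p = 0.
      move=> s0 s1; apply: bumpf_out; apply: le_trans (ltW tQ).
      by rewrite ler_pXn2r ?nnegrE.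
    by rewrite /D !out// !mulr0 !addr0 lexx.
  have vp : 0 <= v p by apply: v0; apply: (inO t1 _ _ _ Qt).1.
  have T := pos_sq_taylor (t ^+ 2 - quad q p) k.
  have kE : t ^+ 2 - quad q p + k = (t + h) ^+ 2 - quad q p by rewrite /k; ring.
  have -> : D p = v p * (pos (t ^+ 2 - quad q p + k) ^+ 2 -
     pos (t ^+ 2 - quad q p) ^+ 2 - 2 * k * pos (t ^+ 2 - quad q p)).
    by rewrite kE /D /bumpf expr1; ring.
  case/andP: T => T0 Tk; apply/andP; split; first exact: mulr_ge0.
  (* As t + h <= t', the remainder vanishes where Q >= t'^2; elsewhere [bumpf 1 t1 q] is at least c,
     so that k^2 is at most k^2 / c times it. *)
  have [t'Q|Qt'] := leP (t' ^+ 2) (quad q p).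
    rewrite kE !pos_le0E.
    - rewrite expr0n mulr0 !subr0 mulr0 mulr_ge0 ?divr_ge0 ?sqr_ge0 ?(ltW c0)//.
      by rewrite mulr_ge0// bumpf_ge0.
    - rewrite subr_le0 (le_trans _ t'Q)// ler_pXn2r ?nnegrE// /t'; lra.
    - rewrite subr_le0 (le_trans _ t'Q)// ler_pXn2r ?nnegrE// /t'; lra.
  rewrite mulrCA ler_wpM2l// (le_trans Tk)// -mulrA ler_peMr ?sqr_ge0//.
  rewrite /bumpf expr1 mulrC ler_pdivlMr// mul1r pos_gt0E.
    by rewrite /c lerD2l lerN2 ltW.
  by rewrite subr_gt0 (lt_trans Qt')// -subr_gt0.
have D0 : 0 <= pint D by apply: Rintegral_ge0 => p _; case/andP: (Dp p).
have D1 : pint D <= k ^+ 2 / c * I1 t1.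
  rewrite -(pintZ _ c4).
  by apply: (le_pint cD (CcZ _ c4)) => p; case/andP: (Dp p).
have kb : k ^+ 2 <= h ^+ 2 * (t + t1) ^+ 2.
  rewrite -exprMn -[k ^+ 2]real_normK ?num_real// -[(h * _) ^+ 2]real_normK ?num_real//.
  rewrite ler_pXn2r ?nnegrE// /k (_ : 2 * t * h + h ^+ 2 = h * (2 * t + h)); last by ring.
  rewrite !normrM ler_wpM2l// ger0_norm ?ger0_norm; lra.
have D2 : pint D <= h ^+ 2 * ((t + t1) ^+ 2 / c * I1 t1).
  have J0 : 0 <= c^-1 * I1 t1 by rewrite mulr_ge0 ?invr_ge0 ?I0// ltW.
  by apply: (le_trans D1); have := ler_wpM2r J0 kb; rewrite !mulrA.
have -> : mean2 v q (t + h) - mean2 v q t - h * (4 * t * I1 t) =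
    pint D + 2 * I1 t * h ^+ 2 by rewrite DE /k; ring.
have It := I0 t t00 tt1'.
rewrite ger0_norm; last by rewrite addr_ge0// mulr_ge0 ?sqr_ge0// mulr_ge0.
rewrite /C; lra.
Qed.

Lemma bumpf_le n t q p : Om q -> bumpf n t q p <= (t ^+ 2) ^+ n.
Proof.
move=> Oq; rewrite /bumpf lerXn2r ?nnegrE ?pos_ge0 ?sqr_ge0//.
by rewrite /pos ge_max sqr_ge0 gerBl quad_ge0.
Qed.

Lemma bumpf_support n t q p : inbox x0 r q -> 0 <= t -> 0 < bumpf n.+1 t q p ->
  inbox q (m * t) p.
Proof.
move=> xq t0 b0; apply: ellipse_inbox => //; rewrite leNgt; apply/negP => /ltW h.
by move: b0; rewrite bumpf_out// ltxx.
Qed.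

Lemma pint_le_support t q k f : inbox x0 r q -> 0 <= t -> Cc f -> 0 <= k ->
  (forall p, f p <= k) -> (forall p, 0 < f p -> inbox q (m * t) p) ->
  pint f <= k * (4 * m ^+ 2 * t ^+ 2).
Proof.
move=> xq t0 cf k0 fk fs; have mt : 0 <= m * t by rewrite mulr_ge0// ltW.
rewrite (_ : 4 * m ^+ 2 * t ^+ 2 = ((q.1 + m * t) - (q.1 - m * t)) *
  ((q.2 + m * t) - (q.2 - m * t))); last by ring.
by apply: pint_le_box => //; [lra|lra|move=> p /fs/inboxP].
Qed.

Lemma pint_bump3_le t q K : inbox x0 (r / 2) q -> 0 <= t -> m * t <= r / 2 ->
  0 <= K -> pint (fun p => K * bumpf 3 t q p) <= 4 * m ^+ 2 * K * t ^+ 8.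
Proof.
move=> xq t0 tr K0; have xrq := half_r xq.
have cb := Cc_bump_tame 2 xq t0 tr.
rewrite (_ : 4 * _ * _ * _ = K * t ^+ 6 * (4 * m ^+ 2 * t ^+ 2)); last by ring.
apply: (@pint_le_support t q) => //.
- exact: CcZ.
- by rewrite mulr_ge0// exprn_ge0.
- by move=> p; rewrite ler_wpM2l// (le_trans (bumpf_le _ _ _ (tmO xrq)))// -exprM.
- move=> p Kb; apply: (@bumpf_support 2) => //.
  by rewrite lt_neqAle bumpf_ge0 andbT; apply/eqP => h; move: Kb; rewrite -h mulr0 ltxx.
Qed.

(** The first bound keeps ellipses of scale 2 t inside the tame box, the spare factor 2 being the
    room that [is_derive_mean2] asks for. The second keeps errC t below 12, half of the leading
    coefficient 24. *)
Definition t_max := Num.min (r / (4 * m)) (12 / errC).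

Let errC0 : 0 < errC. Proof. by apply: mulr_gt0; [rewrite ltr0n|exact: exprn_gt0]. Qed.

Lemma t_max_gt0 : 0 < t_max.
Proof.
rewrite lt_min; apply/andP; split.
  exact: divr_gt0 r0 (mulr_gt0 _ m0).
exact: divr_gt0 _ errC0.
Qed.

Lemma t_max_box t : t <= t_max -> m * (2 * t) <= r / 2.
Proof.
rewrite le_min => /andP[+ _]; rewrite (ler_pdivlMr _ _ (mulr_gt0 _ m0))//; lra.
Qed.

Lemma t_max_err t : t <= t_max -> errC / 24 * t <= 1 / 2.
Proof.
rewrite le_min => /andP[_]; rewrite (ler_pdivlMr _ _ errC0); lra.
Qed.

Lemma divA_bump3_le v q t K : Ck 2 Om v -> 0 <= K ->
  (forall p, Om p -> divA v p <= K) -> inbox x0 (r / 2) q ->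
  0 <= t -> m * t <= r / 2 ->
  pint (fun p => divA v p * bumpf 3 t q p) <= 4 * m ^+ 2 * K * t ^+ 8.
Proof.
move=> v2 K0 vK xq t0 tr; apply: le_trans (pint_bump3_le xq t0 tr K0).
apply: le_pint.
- by apply: (Cc_tame 2) => // p Op; exact: (continuous_divA v2 Op).
- exact: (CcZ K (Cc_bump_tame 2 xq t0 tr)).
- move=> p; have [Qt|tQ] := leP (quad q p) (t ^+ 2).
    by rewrite ler_wpM2r ?bumpf_ge0// vK//; exact: (tame_ellipse_in xq t0 tr Qt).1.
  by rewrite bumpf_out ?mulr0// ltW.
Qed.

Lemma mean2_ge0 v q t : (forall p, Om p -> 0 <= v p) -> inbox x0 (r / 2) q ->
  0 <= t -> m * t <= r / 2 -> 0 <= mean2 v q t.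
Proof.
move=> v0 xq t0 tr; apply: Rintegral_ge0 => p _.
exact: (bump_ge0v 1 v0 (tame_ellipse_in xq t0 tr)).
Qed.

(* The factor [s^-1 - errC / 24] replaces [s^-1]: it absorbs the deviation of
   the coefficients from their values at [q]. *)
Lemma weak_harnack v q t K : Ck 2 Om v -> (forall p, Om p -> 0 <= v p) ->
  0 <= K -> (forall p, Om p -> divA v p <= K) -> inbox x0 (r / 2) q ->
  0 < t -> t <= t_max ->
  mean2 v q t <= 256 * m ^+ 2 * t ^+ 6 * (v q + K * t ^+ 2).
Proof.
move=> v2 v0 K0 vK xq t0 tM; have xrq := half_r xq; have Oq := tmO xrq.
have bx := t_max_box tM.
pose c := errC / 24.
have c0 : 0 < c by apply: divr_gt0; [exact: errC0|].
have ct : c * t <= 1 / 2 := t_max_err tM.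
have tr s : 0 < s -> s <= t -> m * s <= r / 2.
  by move=> s0 st; apply: le_trans bx; rewrite ler_pM2l//; lra.
have cinv s : 0 < s -> s <= t -> c <= s^-1 / 2.
  move=> s0 st; have cs : c * s <= 1 / 2 by apply: le_trans ct; rewrite ler_pM2l.
  by rewrite -(@ler_pM2r _ s)// (_ : s^-1 / 2 * s = 1 / 2)//; field; rewrite gt_eqF.
(* For M = [mean2 v q] one has M' = 4 s I1, and [key_inequality] becomes s (1 - c s) M' <= 6 M + m^2
   K s^8. The integrating factor (s^-1 - c)^6 removes 6 M; the source then contributes at most m^2 K
   s, of which the subtracted term is a primitive. Hence [chi] is nonincreasing. *)
pose chi s := (s^-1 - c) ^+ 6 * mean2 v q s - m ^+ 2 * K / 2 * s ^+ 2.
pose I1 s := pint (fun p => v p * bumpf 1 s q p).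
pose dchi s := 6 * (s^-1 - c) ^+ 5 * (- s ^- 2) * mean2 v q s
  + (s^-1 - c) ^+ 6 * (4 * s * I1 s) - m ^+ 2 * K * s.
have dchiE s : 0 < s -> s <= t -> is_derive s 1 chi (dchi s).
  move=> s0 st.
  have dm : is_derive s 1 (mean2 v q) (4 * s * I1 s).
    by apply: (is_derive_mean2 (t1 := 2 * t)) => //; lra.
  have dV : is_derive s 1 (fun y : R => y^-1) (- s ^- 2).
    have := @is_deriveV R id s 1 1; rewrite /GRing.scale/= mulr1; by apply; rewrite ?gt_eqF.
  have d1 : is_derive s 1 (fun y : R => y^-1 + - c) (- s ^- 2 + - 0).
    exact: (is_deriveD_fun dV (is_deriveN_fun (is_derive_cst_fun c s 1))).
  have dK : is_derive s 1 (fun y : R => m ^+ 2 * K / 2 * y ^+ 2)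
      (0 * s ^+ 2 + m ^+ 2 * K / 2 * (2 * s ^+ 1 * 1)).
    exact: (is_deriveM_fun (is_derive_cst_fun _ s 1) (is_deriveX_fun 1 (is_derive_id s 1))).
  apply: (is_derive_eq (is_deriveD_fun (is_deriveM_fun (is_deriveX_fun 5 d1) dm)
    (is_deriveN_fun dK))).
  by rewrite /dchi; field; rewrite gt_eqF.
have dchi0 s : 0 < s -> s <= t -> dchi s <= 0.
  move=> s0 st; have ki := key_inequality v2 v0 xq (ltW s0) (tr s s0 st).
  have up := divA_bump3_le v2 K0 vK xq (ltW s0) (tr s s0 st).
  have := le_trans ki up; rewrite -/(I1 s) -/(mean2 v q s) => H.
  have H2 : s ^+ 2 * (1 - c * s) * (4 * I1 s) <= 6 * mean2 v q s + m ^+ 2 * K * s ^+ 8.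
    have -> : s ^+ 2 * (1 - c * s) * (4 * I1 s) = (24 * s ^+ 2 - errC * s ^+ 3) * I1 s / 6.
      by rewrite /c; field.
    have : 0 <= m ^+ 2 * K * s ^+ 8 by rewrite !mulr_ge0// ?exprn_ge0 ?(ltW m0) ?(ltW s0).
    lra.
  pose a := s^-1 - c.
  have sN0 : s != 0 by rewrite gt_eqF.
  have as1 : a * s = 1 - c * s by rewrite /a mulrBl mulVf.
  have cs : c * s <= 1 / 2 by apply: le_trans ct; rewrite ler_pM2l.
  have as0 : 0 < a * s by rewrite as1; lra.
  have a0 : 0 < a by move: as0; rewrite pmulr_lgt0.
  have as5 : (a * s) ^+ 5 <= 1.
    by apply: exprn_ile1; [exact: ltW|rewrite as1; have := mulr_gt0 c0 s0; lra].
  have -> : dchi s = a ^+ 5 * s ^- 2 * (s ^+ 2 * (1 - c * s) * (4 * I1 s) - 6 * mean2 v q s)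
     - m ^+ 2 * K * s by rewrite /dchi -/a -as1; field.
  rewrite subr_le0.
  apply: (@le_trans _ _ (a ^+ 5 * s ^- 2 * (m ^+ 2 * K * s ^+ 8))).
    apply: ler_wpM2l; last lra.
    by rewrite mulr_ge0 ?invr_ge0 ?exprn_ge0// ltW.
  rewrite (_ : a ^+ 5 * _ * _ = (a * s) ^+ 5 * (m ^+ 2 * K * s)); last by field.
  by rewrite ler_piMl// !mulr_ge0// ?sqr_ge0// ltW.
have mono s : 0 < s -> s <= t -> chi t <= chi s.
  move=> s0 st; apply: (@ler0_derive1_le_cc R chi s t) => //.
  - move=> y; rewrite in_itv/= => /andP[sy yt].
    by apply: (@ex_derive _ _ _ _ _ _ _ (dchiE y _ _)); lra.
  - move=> y; rewrite in_itv/= => /andP[sy yt]; rewrite derive1E.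
    have y0 : 0 < y by lra.
    by rewrite (@derive_val _ _ _ _ _ _ _ (dchiE y y0 (ltW yt))) dchi0// ltW.
  - apply: derivable_within_continuous => y; rewrite in_itv/= => /andP[sy yt].
    by apply: (@ex_derive _ _ _ _ _ _ _ (dchiE y _ _)); lra.
  - by rewrite in_itv/= st lexx.
  - by rewrite in_itv/= st lexx.
have vq0 := v0 _ Oq.
(* In place of a limit s -> 0: once v <= v q + eta on the ellipse, the kernel is at most s^4 and
   lives in a box of area 4 m^2 s^2. *)
have small eta : 0 < eta -> exists s, [/\ 0 < s, s <= t & mean2 v q s <=
  (v q + eta) * s ^+ 4 * (4 * m ^+ 2 * s ^+ 2)].
  move=> e0; have [d d0 dv] : exists2 d, 0 < d & forall p, inbox q d p -> v p <= v q + eta.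
    apply: near_inbox; have /cvg_ball/(_ _ e0) := C2_cts v2 Oq.
    by apply: filterS => p; rewrite /ball/= ltr_distl => /andP[? ?]; lra.
  exists (Num.min t (d / m)); set s := Num.min _ _.
  have s0 : 0 < s by rewrite lt_min t0 divr_gt0.
  have st : s <= t by rewrite ge_min lexx.
  have sd : m * s <= d by rewrite -ler_pdivlMl// mulrC ge_min lexx orbT.
  split => //; have inO := tame_ellipse_in xq (ltW s0) (tr s s0 st).
  apply: (@pint_le_support s q) => //; first exact: ltW.
  - by apply: (Cc_tame 1) => //; [exact: ltW|exact: tr|exact: C2_cts].
  - by rewrite mulr_ge0 ?exprn_ge0 ?(ltW s0)//; lra.
  - move=> p; have [Qs|sQ] := leP (quad q p) (s ^+ 2); last first.
      by rewrite bumpf_out ?(ltW sQ)// mulr0 mulr_ge0 ?exprn_ge0 ?(ltW s0)//; lra.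
    have qp : inbox q d p by apply: inbox_le sd _; apply: ellipse_inbox => //; exact: ltW.
    rewrite ler_pM ?bumpf_ge0//; [by apply: v0; exact: (inO _ Qs).1|exact: dv|].
    by rewrite (le_trans (bumpf_le _ _ _ Oq))// -exprM.
  - move=> p vb; apply: (@bumpf_support 1) => //; first exact: ltW.
    by rewrite lt_neqAle bumpf_ge0 andbT; apply/eqP => h; move: vb; rewrite -h mulr0 ltxx.
have tN0 : t != 0 by rewrite gt_eqF.
have main eta : 0 < eta -> mean2 v q t <= 256 * m ^+ 2 * t ^+ 6 * (v q + K * t ^+ 2) +
  256 * m ^+ 2 * t ^+ 6 * eta.
  move=> /small[s [s0 st ms]]; have := mono s s0 st; rewrite /chi => H.
  have sN0 : s != 0 by rewrite gt_eqF.
  have K2 : 0 <= m ^+ 2 * K by rewrite mulr_ge0 ?sqr_ge0.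
  have cs : c * s <= 1 / 2 by apply: le_trans ct; rewrite ler_pM2l.
  have sVc : 0 <= s^-1 - c.
    by have := cinv s s0 st; have := c0; lra.
  have H1 : (s^-1 - c) ^+ 6 * mean2 v q s <= (v q + eta) * (4 * m ^+ 2).
    apply: (@le_trans _ _ (s ^- 6 * ((v q + eta) * s ^+ 4 * (4 * m ^+ 2 * s ^+ 2)))).
      apply: ler_pM => //; first exact: exprn_ge0.
        by apply: mean2_ge0 => //; [exact: ltW|exact: tr].
      by rewrite -exprVn lerXn2r ?nnegrE ?invr_ge0 ?(ltW s0)// gerBl ltW.
    by rewrite le_eqVlt; apply/orP; left; apply/eqP; field.
  (* c t <= 1/2 gives t^-1 - c >= (2 t)^-1. Its sixth power is the 64 in 256 = 64 * 4; the 4 is that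
     of the area. *)
  have H2 : (2 * t) ^- 6 * mean2 v q t <= (t^-1 - c) ^+ 6 * mean2 v q t.
    apply: ler_wpM2r; first by apply: mean2_ge0 => //; [exact: ltW|exact: tr].
    have := cinv t t0 (lexx t); have := c0 => c0' ctV.
    rewrite -exprVn lerXn2r ?nnegrE ?invr_ge0 ?mulr_ge0 ?(ltW t0)//; first lra.
    by rewrite (_ : (2 * t)^-1 = t^-1 / 2); [lra|field].
  have H3 : (2 * t) ^- 6 * mean2 v q t <=
      (v q + eta) * (4 * m ^+ 2) + m ^+ 2 * K / 2 * t ^+ 2.
    have : 0 <= m ^+ 2 * K / 2 * s ^+ 2 by rewrite mulr_ge0 ?sqr_ge0//; lra.
    lra.
  have t6 : 0 < (2 * t) ^+ 6 by rewrite exprn_gt0// mulr_gt0.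
  move: H3; rewrite mulrC ler_pdivrMr// => H3; apply: (le_trans H3).
  have : 0 <= m ^+ 2 * K * t ^+ 2 * t ^+ 6
    by rewrite !mulr_ge0// ?exprn_ge0 ?(ltW t0) ?(ltW m0).
  rewrite (_ : (2 * t) ^+ 6 = 64 * t ^+ 6); last by ring.
  set X := t ^+ 6; lra.
apply/ler_addgt0Pr => e e0.
have D0 : 0 < 256 * m ^+ 2 * t ^+ 6.
  apply: mulr_gt0; last exact: exprn_gt0.
  by apply: mulr_gt0; [rewrite ltr0n|exact: exprn_gt0].
have := main (e / (256 * m ^+ 2 * t ^+ 6)) (divr_gt0 e0 D0).
by rewrite [X in _ <= _ + X]mulrC (divfK (lt0r_neq0 D0)).
Qed.

(** [key_inequality] read in the other direction: its first term is nonnegative for t <= t_max and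
    is dropped, so a large mass of K - div (A grad v) forces a large mean of v. *)
Lemma mass_le v q t K : Ck 2 Om v -> (forall p, Om p -> 0 <= v p) ->
  0 <= K -> inbox x0 (r / 2) q -> 0 < t -> t <= t_max ->
  pint (fun p => (K - divA v p) * bumpf 3 t q p)
    <= 36 * mean2 v q t + 4 * m ^+ 2 * K * t ^+ 8.
Proof.
move=> v2 v0 K0 xq t0 tM; have bx := t_max_box tM; have er := t_max_err tM.
have tr : m * t <= r / 2 by apply: le_trans bx; rewrite ler_pM2l//; lra.
have ki := key_inequality v2 v0 xq (ltW t0) tr.
have I0 : 0 <= pint (fun p => v p * bumpf 1 t q p).
  apply: Rintegral_ge0 => p _.
  exact: (bump_ge0v 0 v0 (tame_ellipse_in xq (ltW t0) tr)).
have A0 : 0 <= 24 * t ^+ 2 - errC * t ^+ 3.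
  rewrite (_ : _ - _ = t ^+ 2 * (24 * (1 - errC / 24 * t))); last by field.
  by rewrite mulr_ge0 ?sqr_ge0//; lra.
have cK := Cc_bump_tame 2 xq (ltW t0) tr.
have cd : Cc (fun p => divA v p * bumpf 3 t q p).
  by apply: (Cc_tame 2) => //; [exact: ltW|move=> p Op; exact: (continuous_divA v2 Op)].
have -> : (fun p => (K - divA v p) * bumpf 3 t q p) =
   (fun p => K * bumpf 3 t q p + (- 1) * (divA v p * bumpf 3 t q p)).
  by apply/funext => p; ring.
rewrite (pintD (CcZ _ cK) (CcZ _ cd)) (pintZ _ cd).
have := pint_bump3_le xq (ltW t0) tr K0.
have := mulr_ge0 A0 I0; rewrite /mean2; lra.
Qed.

(** * Spreading of lower bounds, and the mass near a maximum *)

Let tM0 : 0 < t_max. Proof. exact: t_max_gt0. Qed.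

(** Two points of the box are within 2 s of each other, and 4 m (2 s)^2 = (4/9) t^2 / m <= t^2 / 2:
    hence the factor 6. *)
Lemma quad_small t s q p : 0 < t -> s = t / (6 * m) -> s <= r ->
  inbox x0 s q -> inbox x0 s p -> quad q p <= t ^+ 2 / 2.
Proof.
move=> t0 sE sr xq xp.
have xrq := inbox_le sr xq.
have qp : inbox q (s + s) p by apply: inbox_trans (inbox_sym xq) xp.
apply: (le_trans (quad_bound xrq qp)).
have -> : 4 * m * (s + s) ^+ 2 = t ^+ 2 * (4 / 9 * m^-1).
  by rewrite sE; field; rewrite gt_eqF.
apply: ler_wpM2l; first exact: sqr_ge0.
have : m^-1 <= 1 by rewrite invf_le1.
lra.
Qed.

Lemma bumpf_ge n t q p : quad q p <= t ^+ 2 / 2 -> (t ^+ 2 / 2) ^+ n <= bumpf n t q p.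
Proof.
move=> Qt; have t2 := sqr_ge0 t.
rewrite /bumpf lerXn2r ?nnegrE ?pos_ge0//; first lra.
by rewrite /pos le_max; apply/orP; right; lra.
Qed.

(** Three nested scales around x0. Kernels of scale t_max centred in the [sigma] box are bounded
    below on that whole box; the ellipse of scale [tau] about x0 lies in it; boxes of half side
    [rho] about points of the [rho] box lie where the kernel of scale [tau] about x0 is bounded
    below. *)
Definition sigma := t_max / (6 * m).
Definition tau := Num.min t_max (sigma / m).
Definition rho := tau / (6 * m) / 2.

Let sg0 : 0 < sigma. Proof. by rewrite divr_gt0// mulr_gt0. Qed.
Let tau0 : 0 < tau. Proof. by rewrite lt_min tM0 divr_gt0. Qed.
Lemma rho_gt0 : 0 < rho. Proof. by rewrite !divr_gt0// mulr_gt0. Qed.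

Lemma sigma_le : sigma <= r / 2.
Proof.
have : m * (2 * t_max) <= r / 2 := t_max_box (lexx _).
move=> h; rewrite /sigma ler_pdivrMr ?mulr_gt0//.
have : m * 1 <= m * m by rewrite ler_pM2l.
have := mulr_gt0 m0 tM0; have := tM0; have := m1; have := r0; nra.
Qed.

Lemma tau_le : tau <= t_max. Proof. by rewrite ge_min lexx. Qed.

Lemma tau_sigma : m * tau <= sigma.
Proof. by rewrite mulrC -ler_pdivlMr// ge_min lexx orbT. Qed.

Lemma rho2_sigma : 2 * rho <= sigma.
Proof.
rewrite /rho /sigma (_ : 2 * (tau / (6 * m) / 2) = tau / (6 * m)); last by field;
  rewrite gt_eqF.
by rewrite ler_pM2r ?invr_gt0 ?mulr_gt0//; exact: tau_le.
Qed.

Let rho_half q : inbox x0 rho q -> inbox x0 (r / 2) q.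
Proof.
by apply: inbox_le; have := rho2_sigma; have := sigma_le; have := rho_gt0; lra.
Qed.

Lemma rho_sub p : inbox x0 rho p -> Om p.
Proof. by move=> /rho_half/half_r/tmO. Qed.

(** The small box contributes at least d s^2 t^4, with t = t_max, to the mean of v around any q of
    the [rho] box, and [weak_harnack] bounds this mean by the value at q. *)
Lemma positivity_spreads : exists2 C, 0 < C & forall v K, Ck 2 Om v ->
  (forall p, Om p -> 0 <= v p) -> 0 <= K -> (forall p, Om p -> divA v p <= K) ->
  forall y s d q, 0 < s -> 0 <= d ->
  (forall p, inbox y s p -> inbox x0 rho p /\ d <= v p) ->
  inbox x0 rho q -> d * s ^+ 2 <= C * (v q + K).
Proof.
set t := t_max; have t0 : 0 < t := tM0.
exists (256 * m ^+ 2 * t ^+ 2 * (1 + t ^+ 2)).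
  apply: mulr_gt0; last by have := sqr_ge0 t; lra.
  apply: mulr_gt0; last exact: exprn_gt0.
  by apply: mulr_gt0; [rewrite ltr0n|exact: exprn_gt0].
move=> v K v2 v0 K0 vK y s d q s0 d0 ys xq.
have xrq := rho_half xq.
have rs : rho <= sigma by have := rho2_sigma; have := rho_gt0; lra.
have sr : sigma <= r by have := sigma_le; have := r0; lra.
have tr : m * t <= r / 2.
  by apply: le_trans (t_max_box (lexx _)); rewrite ler_pM2l// -/t; lra.
have inO := tame_ellipse_in xrq (ltW t0) tr.
have lower : d * (t ^+ 2 / 2) ^+ 2 * ((y.1 + s - (y.1 - s)) * (y.2 + s - (y.2 - s))) <=
  mean2 v q t.
  apply: pint_ge_box; [lra|lra| | |].
  - by apply: (Cc_tame 1) => //; [exact: ltW|exact: C2_cts].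
  - exact: (bump_ge0v 1 v0 inO).
  - move=> p p1 p2; have [xp dv] := ys p ((inboxP _ _ _).2 (conj p1 p2)).
    apply: ler_pM; [exact: d0|by apply/exprn_ge0/divr_ge0; [exact: sqr_ge0|]|exact: dv|].
    apply: bumpf_ge; apply: (quad_small t0 erefl sr); exact: inbox_le rs _.
have upper := weak_harnack v2 v0 K0 vK xrq t0 (lexx _).
have := le_trans lower upper.
rewrite (_ : d * _ * _ = (d * s ^+ 2) * t ^+ 4); last by field.
rewrite (_ : 256 * m ^+ 2 * t ^+ 6 * (v q + K * t ^+ 2) =
  256 * m ^+ 2 * t ^+ 2 * (v q + K * t ^+ 2) * t ^+ 4); last by ring.
rewrite ler_pM2r ?exprn_gt0// => /le_trans; apply.
rewrite -[X in _ <= X]mulrA; apply: ler_wpM2l.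
  apply: mulr_ge0; last exact: sqr_ge0.
  by apply: mulr_ge0; [exact: ler0n|exact: sqr_ge0].
have vq := v0 _ (tmO (half_r xrq)).
have := mulr_ge0 (sqr_ge0 t) vq; rewrite mulrDl mul1r mulrDr; lra.
Qed.

(** On the box of half side t / (3 m), of area 4 t^2 / (9 m^2), the kernel is at least t^4 / 4. *)
Lemma bump2_mass p t : inbox x0 (r / 2) p -> 0 < t -> m * t <= r / 2 ->
  t ^+ 6 / (9 * m ^+ 2) <= pint (bumpf 2 t p).
Proof.
move=> xp t0 tr; pose d := t / (3 * m).
have d0 : 0 < d by rewrite divr_gt0// mulr_gt0.
have mN0 : m != 0 by rewrite gt_eqF.
have mV : m^-1 <= 1 by rewrite invf_le1.
rewrite (_ : t ^+ 6 / _ = (t ^+ 2 / 2) ^+ 2 *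
  ((p.1 + d - (p.1 - d)) * (p.2 + d - (p.2 - d)))); last by rewrite /d; field.
apply: pint_ge_box; [lra|lra| | |].
- exact: Cc_bump_tame (ltW t0) tr.
- by move=> z; exact: bumpf_ge0.
- move=> z z1 z2; apply: bumpf_ge.
  apply: (le_trans (quad_bound (half_r xp) ((inboxP _ _ _).2 (conj z1 z2)))).
  rewrite (_ : 4 * m * d ^+ 2 = t ^+ 2 * (4 / 9 * m^-1)); last by rewrite /d; field.
  by apply: ler_wpM2l; [exact: sqr_ge0|lra].
Qed.

Lemma exp_mean_ge z p t T : Ck 2 Om z -> inbox x0 (r / 2) p -> 0 < t ->
  m * t <= r / 2 -> mean2 z p t <= T * pint (bumpf 2 t p) ->
  expR (- T) * pint (bumpf 2 t p)
    <= pint (fun x => expR (- z x) * bumpf 2 t p x).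
Proof.
move=> z2 xp t0 tr mz; have t00 := ltW t0.
have cb := Cc_bump_tame 1 xp t00 tr.
have cz : Cc (fun x => z x * bumpf 2 t p x) by apply: (Cc_tame 1) => //; exact: C2_cts z2.
have ce : Cc (fun x => expR (- z x) * bumpf 2 t p x).
  apply: (Cc_tame 1) => // x Ox.
  apply: (@continuous_comp _ _ _ (fun x => - z x) (@expR R)).
    exact: (ctsN (C2_cts z2 Ox)).
  exact: continuous_expR.
(* Jensen, through the tangent line e^-z >= e^-T (1 + T - z) *)
apply: (@le_trans _ _ (pint (fun x => expR (- T) * (1 + T) * bumpf 2 t p x
   + (- expR (- T)) * (z x * bumpf 2 t p x)))).
  rewrite (pintD (CcZ _ cb) (CcZ _ cz)) (pintZ _ cb) (pintZ _ cz).
  by have := ler_wpM2l (expR_ge0 (- T)) mz; rewrite /mean2; lra.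
apply: (le_pint (CcD (CcZ _ cb) (CcZ _ cz)) ce) => x.
have -> : expR (- T) * (1 + T) * bumpf 2 t p x + - expR (- T) * (z x * bumpf 2 t p x)
  = expR (- T) * (1 + (T - z x)) * bumpf 2 t p x by ring.
apply: ler_wpM2r; first exact: bumpf_ge0.
have -> : expR (- z x) = expR (- T) * expR (T - z x).
  by rewrite -expRD; congr expR; ring.
by apply: ler_wpM2l; [exact: expR_ge0|exact: expR_ge1Dx].
Qed.

(** [lam] stands for a multiple of e^(max u) and may be huge, yet [C] depends on [L] and not on
    [lam]: a density of order lam on an area of order t^2 has mass of order lam t^2, hence of order
    min (1, lam). This mass bounds from below the mean of u - l around x0, then around q, and
    finally its value at q. *)
Lemma max_has_mass L : 0 <= L -> exists2 C, 0 < C & forall u K lam mx l p,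
  Ck 2 Om u -> (forall z, Om z -> l <= u z <= mx) -> 0 <= K -> 0 < lam ->
  inbox x0 rho p -> u p = mx ->
  (forall z, Om z -> lam * expR (u z - mx) <= K - divA u z) ->
  (forall z, Om z -> - divA u z <= L * lam) ->
  forall q, inbox x0 rho q -> Num.min 1 lam <= C * (u q - l + K).
Proof.
move=> L0; pose tM := t_max; have tMt : 0 < tM := tM0.
pose t2 := Num.min 1 (rho / m).
have t20 : 0 < t2 by rewrite lt_min ltr01 divr_gt0// rho_gt0.
(* [T] is the quotient of the bound 256 m^2 L t^6 of [weak_harnack] by the lower bound t^6 / (9 m^2)
   of [bump2_mass]. Below, c min (1, lam) bounds the mass from below and D (u q - l + K) from
   above. *)
pose T := 9 * m ^+ 2 * (256 * m ^+ 2 * L).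
pose c := tau ^+ 6 / 8 * (expR (- T) / (9 * m ^+ 2)) * t2 ^+ 2.
pose D := 36 * (4 * (256 * m ^+ 2 * tM ^+ 6 * (1 + tM ^+ 2))) + 4 * m ^+ 2 * tau ^+ 8.
have m2 : 0 < m ^+ 2 by exact: exprn_gt0.
have c0 : 0 < c.
  apply: mulr_gt0; last exact: exprn_gt0.
  apply: mulr_gt0; first by apply: divr_gt0 => //; exact: exprn_gt0.
  by apply: divr_gt0; [exact: expR_gt0|exact: mulr_gt0].
have k0 : 0 <= 256 * m ^+ 2 * tM ^+ 6.
  by apply: mulr_ge0; [apply: mulr_ge0; [exact: ler0n|exact: ltW]|apply/exprn_ge0/ltW].
have t80 : 0 <= 4 * m ^+ 2 * tau ^+ 8.
  by apply: mulr_ge0; [apply: mulr_ge0; [exact: ler0n|exact: ltW]|apply/exprn_ge0/ltW].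
have D0 : 0 <= D.
  apply: addr_ge0 t80; apply: mulr_ge0; first exact: ler0n.
  apply: mulr_ge0; first exact: ler0n.
  by apply: mulr_ge0 k0 _; have := sqr_ge0 tM; lra.
exists (D / c + 1); first by have := divr_ge0 D0 (ltW c0); lra.
move=> u K lam mx l p u2 ulm K0 lam0 xp up lo hi q xq.
pose mn := Num.min 1 lam; have mn0 : 0 < mn by rewrite lt_min ltr01.
(* Scale of the blow-up: lam t^2 is a fixed multiple of min (1, lam), so that
   [weak_harnack] keeps [mx - u] bounded on average at scale t around [p]. *)
pose t := t2 / Num.sqrt (Num.max 1 lam).
have mx1 : 1 <= Num.max 1 lam by rewrite le_max lexx.
have mx0 : 0 < Num.max 1 lam by apply: lt_le_trans mx1.
have sq1 : 1 <= Num.sqrt (Num.max 1 lam) by rewrite -[X in X <= _]sqrtr1 ler_sqrt// ltW.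
have sq0 : 0 < Num.sqrt (Num.max 1 lam) by exact: lt_le_trans sq1.
have t0 : 0 < t by rewrite divr_gt0.
have tt2 : t <= t2 by rewrite ler_pdivrMr// ler_peMr// ltW.
have lamt : lam * t ^+ 2 = t2 ^+ 2 * mn.
  rewrite /t expr_div_n sqr_sqrtr ?(ltW mx0)// /mn maxEle minEle.
  by case: ifP => _; field; rewrite ?gt_eqF.
have lamt1 : lam * t ^+ 2 <= 1.
  rewrite lamt; apply: mulr_ile1; [exact: sqr_ge0|exact: ltW| |by rewrite ge_min lexx].
  by apply: exprn_ile1; [exact: ltW|rewrite ge_min lexx].
have mt : m * t <= rho.
  apply: (@le_trans _ _ (m * t2)); first by rewrite ler_pM2l.
  by rewrite mulrC -ler_pdivlMr// ge_min lexx orbT.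
have rs : rho <= sigma by have := rho2_sigma; have := rho_gt0; lra.
have sr := sigma_le.
have sM : sigma <= tM.
  by rewrite /sigma ler_pdivrMr ?mulr_gt0// ler_peMr//; [exact: ltW|have := m1; lra].
have tM' : t <= tM.
  have : t <= m * t by rewrite ler_peMl// ltW.
  by have := rs; lra.
have tr : m * t <= r / 2 by lra.
have taur : m * tau <= r / 2 by have := tau_sigma; lra.
have xrp := rho_half xp; have xrq := rho_half xq.
have xr0 : inbox x0 (r / 2) x0 by apply: inbox_refl; have := r0; lra.
have t00 := ltW t0.
(* Both are in the form c * u + d of [Ck_affine] and [divA_affine]. [z] vanishes at the maximum
   point, which is where [weak_harnack] is applied to it. *)
pose z x := (-1) * u x + mx; pose v x := 1 * u x + (- l).
have z2 : Ck 2 Om z := Ck_affine _ _ u2.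
have v2 : Ck 2 Om v := Ck_affine _ _ u2.
have z0 x : Om x -> 0 <= z x by move=> /ulm/andP[_]; rewrite /z; lra.
have v0 x : Om x -> 0 <= v x by move=> /ulm/andP[+ _]; rewrite /v; lra.
have dz x : Om x -> divA z x <= L * lam.
  by move=> Ox; rewrite divA_affine// mulN1r; exact: hi.
have dvE x : Om x -> divA v x = divA u x.
  by move=> Ox; rewrite divA_affine// mul1r.
have dvK x : Om x -> divA v x <= K.
  move=> Ox; rewrite dvE//; have := lo _ Ox.
  by have := mulr_gt0 lam0 (expR_gt0 (u x - mx)); lra.
have zE x : - z x = u x - mx by rewrite /z; ring.
have meanz : mean2 z p t <= T * pint (bumpf 2 t p).
  have := weak_harnack z2 z0 (mulr_ge0 L0 (ltW lam0)) dz xrp t0 tM'.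
  have -> : z p = 0 by rewrite /z up; ring.
  rewrite add0r => /le_trans; apply.
  apply: (@le_trans _ _ (T * (t ^+ 6 / (9 * m ^+ 2)))); last first.
    apply: ler_wpM2l; last exact: bump2_mass.
    by rewrite /T !mulr_ge0 ?ler0n// ltW.
  have -> : T * (t ^+ 6 / (9 * m ^+ 2)) = 256 * m ^+ 2 * t ^+ 6 * L.
    by rewrite /T; field; rewrite gt_eqF.
  apply: ler_wpM2l.
    by apply: mulr_ge0; [apply: mulr_ge0; [exact: ler0n|exact: ltW]|apply/exprn_ge0/ltW].
  by rewrite -mulrA ler_piMr.
have expm := exp_mean_ge z2 xrp t0 tr meanz.
(* On the support of [bumpf 2 t p], this kernel is at most t^4 while [bumpf 3 tau x0] is at least
   (tau^2 / 2)^3 = tau^6 / 8. *)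
pose k := tau ^+ 6 / 8 * t ^- 4 * lam.
have k1 : 0 <= k.
  by rewrite /k mulr_ge0 ?(ltW lam0)// mulr_ge0 ?invr_ge0 ?exprn_ge0//
    divr_ge0 ?exprn_ge0 ?(ltW tau0).
have ce : Cc (fun x => expR (- z x) * bumpf 2 t p x).
  apply: (Cc_tame 1) => // x Ox.
  apply: (@continuous_comp _ _ _ (fun x => - z x) (@expR R)).
    exact: (ctsN (C2_cts z2 Ox)).
  exact: continuous_expR.
have cK : Cc (fun x => (K - divA v x) * bumpf 3 tau x0 x).
  apply: (Cc_tame 2) => //; first exact: ltW.
  move=> x Ox; apply: (@ctsD _ x (fun=> K) (fun x => - divA v x)); first exact: cts_cst.
  by apply: ctsN; exact: (continuous_divA v2 Ox).
have inO0 := tame_ellipse_in xr0 (ltW tau0) taur.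
have Op := tmO (half_r xrp).
have compare : k * pint (fun x => expR (- z x) * bumpf 2 t p x)
    <= pint (fun x => (K - divA v x) * bumpf 3 tau x0 x).
  rewrite -(pintZ _ ce); apply: (le_pint (CcZ _ ce) cK) => x.
  have [b0|b0] := leP (bumpf 2 t p x) 0.
    have -> : bumpf 2 t p x = 0 by apply/eqP; rewrite eq_le b0 bumpf_ge0.
    rewrite !mulr0; have [Qt|tQ] := leP (quad x0 x) (tau ^+ 2).
      rewrite mulr_ge0 ?bumpf_ge0// subr_ge0; apply: dvK.
      exact: (inO0 _ Qt).1.
    by rewrite bumpf_out ?mulr0// ltW.
  have px := bumpf_support (half_r xrp) t00 b0.
  have rr : tau / (6 * m) = rho + rho by rewrite /rho; field; rewrite gt_eqF.
  have x2r : inbox x0 (tau / (6 * m)) x.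
    by apply: inbox_le (inbox_trans xp px); rewrite rr lerD2l.
  have t6r : tau / (6 * m) <= r.
    by rewrite rr; have := rho2_sigma; have := r0; lra.
  have t6 : 0 <= tau / (6 * m) by rewrite divr_ge0 ?mulr_ge0 ?(ltW tau0) ?(ltW m0).
  have Ox := tmO (inbox_le t6r x2r).
  have b3 : (tau ^+ 2 / 2) ^+ 3 <= bumpf 3 tau x0 x.
    apply: bumpf_ge; apply: (quad_small tau0 erefl t6r) => //; exact: inbox_refl.
  have b2 : bumpf 2 t p x <= t ^+ 4 by rewrite (le_trans (bumpf_le _ _ _ Op))// -exprM.
  rewrite dvE// (_ : k * _ = (lam * expR (u x - mx)) * ((tau ^+ 2 / 2) ^+ 3 *
    (t ^- 4 * bumpf 2 t p x))); last first.
    by rewrite zE /k; field; rewrite gt_eqF.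
  apply: ler_pM; [by rewrite mulr_ge0 ?expR_ge0 ?ltW| |exact: lo|].
    apply: mulr_ge0; first by rewrite exprn_ge0// divr_ge0 ?sqr_ge0.
    by apply: mulr_ge0; [rewrite invr_ge0 exprn_ge0|exact: bumpf_ge0].
  apply: le_trans b3; rewrite ler_piMr ?exprn_ge0 ?divr_ge0 ?sqr_ge0//.
  by rewrite mulrC ler_pdivrMr ?exprn_gt0// mul1r.
have mass := mass_le v2 v0 K0 xr0 tau0 tau_le.
(* Recentres the mean from x0 to q: on the [sigma] box the kernel around q is at least tM^4 / 4, and
   the one around x0 is at most tau^4 <= tM^4. *)
have mean4 : mean2 v x0 tau <= 4 * mean2 v q tM.
  have tMr : m * tM <= r / 2.
    by apply: le_trans (t_max_box (lexx _)); rewrite ler_pM2l// -/tM; lra.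
  have inOq := tame_ellipse_in xrq (ltW tMt) tMr.
  have cq : Cc (fun x => v x * bumpf 2 tM q x) by apply: (Cc_tame 1) => //;
    [exact: ltW|exact: C2_cts v2].
  have c0' : Cc (fun x => v x * bumpf 2 tau x0 x) by apply: (Cc_tame 1) => //;
    [exact: ltW|exact: C2_cts v2].
  rewrite -(pintZ _ cq); apply: (le_pint c0' (CcZ _ cq)) => x.
  have [b0|b0] := leP (bumpf 2 tau x0 x) 0.
    have -> : bumpf 2 tau x0 x = 0 by apply/eqP; rewrite eq_le b0 bumpf_ge0.
    by rewrite mulr0 mulr_ge0//; exact: (bump_ge0v 1 v0 inOq).
  have xs : inbox x0 sigma x.
    by apply: inbox_le tau_sigma _; exact: bumpf_support (half_r xr0) (ltW tau0) b0.
  have sr' : sigma <= r by have := r0; lra.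
  have Ox := tmO (inbox_le sr' xs).
  have bq : (tM ^+ 2 / 2) ^+ 2 <= bumpf 2 tM q x.
    by apply: bumpf_ge; apply: (quad_small tMt erefl sr') => //; exact: inbox_le rs _.
  rewrite [4 * _]mulrCA; apply: ler_wpM2l; first exact: v0.
  apply: (le_trans (bumpf_le _ _ _ (tmO (half_r xr0)))).
  have : (tau ^+ 2) ^+ 2 <= (tM ^+ 2) ^+ 2.
    by rewrite !lerXn2r ?nnegrE ?sqr_ge0 ?(ltW tau0) ?(ltW tMt)//; exact: tau_le.
  move: bq; rewrite expr_div_n; lra.
have wh := weak_harnack v2 v0 K0 dvK xrq tMt (lexx _).
have vq : 0 <= v q := v0 _ (tmO (half_r xrq)).
have final : c * mn <= D * (v q + K).
  have e1 : c * mn <= k * pint (fun x => expR (- z x) * bumpf 2 t p x).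
    apply: (@le_trans _ _ (k * (expR (- T) * (t ^+ 6 / (9 * m ^+ 2))))).
      rewrite /c -mulrA -lamt /k le_eqVlt; apply/orP; left; apply/eqP.
      by field; rewrite !gt_eqF.
    apply: ler_wpM2l => //; apply: le_trans expm.
    by apply: ler_wpM2l; [exact: expR_ge0|exact: bump2_mass].
  apply: (le_trans e1); apply: (le_trans compare); apply: (le_trans mass).
  have e2 : mean2 v x0 tau <= 4 * (256 * m ^+ 2 * tM ^+ 6 * (1 + tM ^+ 2)) * (v q + K).
    apply: (le_trans mean4).
    rewrite (_ : 4 * _ * _ = 4 * (256 * m ^+ 2 * tM ^+ 6 * ((1 + tM ^+ 2) *
      (v q + K)))); last by ring.
    rewrite ler_pM2l//; apply: (le_trans wh); apply: ler_wpM2l => //.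
    move: (v q) vq => w w0; have := mulr_ge0 (sqr_ge0 tM) w0.
    by rewrite mulrDl mul1r mulrDr; lra.
  have -> : D * (v q + K) = 36 * (4 * (256 * m ^+ 2 * tM ^+ 6 * (1 + tM ^+ 2)) * (v q + K))
    + 4 * m ^+ 2 * tau ^+ 8 * (v q + K) by rewrite /D; ring.
  apply: lerD; first by apply: ler_wpM2l; [exact: ler0n|exact: e2].
  rewrite (_ : 4 * m ^+ 2 * K * tau ^+ 8 = 4 * m ^+ 2 * tau ^+ 8 * K); last by ring.
  by apply: ler_wpM2l => //; rewrite lerDr.
have almost : mn <= D / c * (v q + K) by rewrite mulrAC ler_pdivlMr// mulrC.
rewrite -/mn; have -> : u q - l = v q by rewrite /v mul1r.
apply: (le_trans almost); apply: ler_wpM2r; first exact: addr_ge0.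
by rewrite lerDl.
Qed.

End elliptic.

(** * Riemannian metrics in a chart and the divergence form of the Laplacian *)

Lemma det_mx2 (R : comPzRingType) (A : 'M[R]_2) : \det A =
  A ord0 ord0 * A ord_max ord_max - A ord0 ord_max * A ord_max ord0.
Proof.
rewrite (expand_det_row _ ord0) !big_ord_recl big_ord0 /cofactor !det_mx11 !mxE /=.
rewrite expr0 expr1 mul1r addr0 mulN1r mulrN.
by congr (A _ _ * A _ _ - A _ _ * A _ _); exact: val_inj.
Qed.

Section regularity.
Context (R : realType) (Om : set (R * R)).
Hypothesis oOm : open Om.
Implicit Types (f h : R * R -> R).

Lemma Ck_subset k (D E : set (R * R)) f : E `<=` D -> Ck k D f -> Ck k E f.
Proof.
move=> ED; elim: k f => [|k IH] f [cf df]; split => //; try by move=> p /ED/cf.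
by move=> a; have [d c] := df a; split; [move=> p /ED/d|exact: IH].
Qed.

Lemma C1_comp (phi dphi : R -> R) h : Ck 1 Om h ->
  (forall p, Om p -> is_derive (h p) 1 phi (dphi (h p))) ->
  (forall p, Om p -> {for h p, continuous dphi}) ->
  Ck 1 Om (fun p => phi (h p)).
Proof.
move=> h1 dE cd; apply: (C1_intro oOm (dh := fun a p => dphi (h p) * partial a h p)).
- move=> p Op; apply: (@continuous_comp _ _ _ h phi).
    exact: Ck_continuous h1 Op.
  apply/differentiable_continuous/derivable1_diffP.
  by apply: (@ex_derive _ _ _ _ _ _ _ (dE p Op)).
- by move=> a p Op; exact: (is_derive_comp_line (Ck_is_derive a h1 Op) (dE p Op)).
- move=> a p Op; apply: (@ctsM _ p (fun p => dphi (h p))).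
    apply: (@continuous_comp _ _ _ h dphi); last exact: cd.
    exact: Ck_continuous h1 Op.
  exact: Ck_continuous (Ck_partial a h1) Op.
Qed.

Lemma C1_inv_sqrt h : Ck 1 Om h -> (forall p, Om p -> 0 < h p) ->
  Ck 1 Om (fun p => (Num.sqrt (h p))^-1).
Proof.
move=> h1 h0.
apply: (@C1_comp (fun s => (Num.sqrt s)^-1)
  (fun s => - (Num.sqrt s) ^- 2 * (2 * Num.sqrt s)^-1)) => // p Op.
  have s0 : Num.sqrt (h p) != 0 by rewrite gt_eqF// sqrtr_gt0 h0.
  by apply: is_deriveV => //; apply: is_derive1_sqrt; exact: h0.
have s0 : Num.sqrt (h p) != 0 by rewrite gt_eqF// sqrtr_gt0 h0.
apply: cvgM.
  apply: cvgN; apply: cvgV; first by rewrite expf_neq0.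
  by apply: (@continuous_comp _ _ _ (@Num.sqrt R) (fun x => x ^+ 2));
    [exact: sqrt_continuous|exact: exprn_continuous].
apply: cvgV; first by rewrite mulf_neq0.
by apply: cvgM; [exact: cvg_cst|exact: sqrt_continuous].
Qed.

End regularity.

Section metric_coefficients.
Context (R : realType) (M : topologicalType) (S : smooth_surface R M)
  (g : riemannian_metric S) (i : chart_index S).
Implicit Types (p : R * R).

(* (metA, metB; metB, metC) is sqrt (det g) g^-1, which has determinant 1. *)
Definition gdet p := metric_mx g i p i0 i0 * metric_mx g i p i1 i1
  - metric_mx g i p i0 i1 ^+ 2.
Definition metA p := metric_mx g i p i1 i1 * (Num.sqrt (gdet p))^-1.
Definition metB p := - metric_mx g i p i0 i1 * (Num.sqrt (gdet p))^-1.
Definition metC p := metric_mx g i p i0 i0 * (Num.sqrt (gdet p))^-1.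

Lemma metric_sym_entry p : chart_image i p ->
  metric_mx g i p i1 i0 = metric_mx g i p i0 i1.
Proof. by move=> Dp; rewrite -[in LHS](Defs.metric_sym g Dp) mxE. Qed.

Lemma metric_form p (x y : R) : chart_image i p -> (x != 0) || (y != 0) ->
  0 < x ^+ 2 * metric_mx g i p i0 i0 + 2 * x * y * metric_mx g i p i0 i1
    + y ^+ 2 * metric_mx g i p i1 i1.
Proof.
move=> Dp xy; pose v : 'rV[R]_2 := \row_j (if j == i0 then x else y).
have v0 : v != 0.
  apply/eqP => /rowP v0; have := v0 i0; have := v0 i1; rewrite !mxE /= => y0 x0.
  by move: xy; rewrite x0 y0 eqxx.
have := metric_pos g Dp v0.
rewrite !mxE !big_ord_recl !big_ord0 !mxE !big_ord_recl !big_ord0 !mxE /=.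
have -> : lift ord0 ord0 = i1 :> 'I_2 by exact: val_inj.
by rewrite /= metric_sym_entry// => /lt_le_trans; apply; rewrite le_eqVlt; apply/orP;
  left; apply/eqP; ring.
Qed.

Lemma metric00_gt0 p : chart_image i p -> 0 < metric_mx g i p i0 i0.
Proof.
move=> Dp; have := @metric_form p 1 0 Dp; rewrite oner_eq0 => /(_ isT).
by rewrite expr1n mul1r mulr0 mul0r expr0n mul0r !addr0.
Qed.

Lemma metric11_gt0 p : chart_image i p -> 0 < metric_mx g i p i1 i1.
Proof.
move=> Dp; have := @metric_form p 0 1 Dp; rewrite oner_eq0 orbT => /(_ isT).
by rewrite expr1n mul1r mulr0 !mul0r expr0n mul0r !add0r.
Qed.

Lemma gdet_gt0 p : chart_image i p -> 0 < gdet p.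
Proof.
move=> Dp; have g00 := metric00_gt0 Dp.
(* On the vector (- g01, g00) the form takes the value g00 det g. *)
have := @metric_form p (- metric_mx g i p i0 i1) (metric_mx g i p i0 i0) Dp.
rewrite (gt_eqF g00) orbT => /(_ isT).
by rewrite (_ : _ + _ = metric_mx g i p i0 i0 * gdet p) ?pmulr_rgt0// /gdet; ring.
Qed.

Lemma metric_detE p : chart_image i p -> \det (metric_mx g i p) = gdet p.
Proof. by move=> Dp; rewrite det_mx2 metric_sym_entry. Qed.

Lemma volume_densityE p : chart_image i p ->
  volume_density g i p = Num.sqrt (gdet p).
Proof. by move=> Dp; rewrite /volume_density metric_detE. Qed.

Lemma volume_density_gt0 p : chart_image i p -> 0 < volume_density g i p.
Proof. by move=> Dp; rewrite volume_densityE// sqrtr_gt0 gdet_gt0. Qed.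

Lemma invmx_metric p : chart_image i p -> invmx (metric_mx g i p) =
  \matrix_(a, b) ((if a == i0 then
    (if b == i0 then metric_mx g i p i1 i1 else - metric_mx g i p i0 i1)
    else (if b == i0 then - metric_mx g i p i0 i1 else metric_mx g i p i0 i0))
    / gdet p).
Proof.
move=> Dp; set B := (X in _ = X).
have d0 : gdet p != 0 by rewrite gt_eqF// gdet_gt0.
have AB : metric_mx g i p *m B = 1%:M.
  apply/matrixP => a b; rewrite !mxE !big_ord_recl big_ord0 !mxE.
  have -> : lift ord0 ord0 = i1 :> 'I_2 by exact: val_inj.
  have s := metric_sym_entry Dp.
  have [->|->] := ord2_cases a; have [->|->] := ord2_cases b;
    rewrite /= ?s /gdet; field; exact: d0.
have uA : metric_mx g i p \in unitmx by rewrite unitmxE metric_detE// unitfE.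
by rewrite -[LHS]mulmx1 -AB mulKmx.
Qed.

Context (Om : set (R * R)) (oOm : open Om) (OmD : Om `<=` chart_image i).

Lemma C1_metric a b : Ck 1 Om (fun p => metric_mx g i p a b).
Proof. exact: Ck_subset OmD (metric_smooth g i a b 1). Qed.

Lemma C1_opp (h : R * R -> R) : Ck 1 Om h -> Ck 1 Om (fun p => - h p).
Proof.
move=> h1; have -> : (fun p => - h p) = (fun p => (-1) * h p + 0).
  by apply/funext => p; ring.
exact: Ck_affine.
Qed.

Lemma C1_gdet : Ck 1 Om gdet.
Proof.
apply: (C1D oOm); first by apply: (C1M oOm); exact: C1_metric.
by apply: C1_opp; apply: (C1M oOm); exact: C1_metric.
Qed.

Lemma C1_gdetV : Ck 1 Om (fun p => (Num.sqrt (gdet p))^-1).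
Proof.
by apply: C1_inv_sqrt => //; [exact: C1_gdet|move=> p /OmD; exact: gdet_gt0].
Qed.

Lemma C1_metA : Ck 1 Om metA.
Proof. by apply: (C1M oOm); [exact: C1_metric|exact: C1_gdetV]. Qed.

Lemma C1_metB : Ck 1 Om metB.
Proof. by apply: (C1M oOm); [apply: C1_opp; exact: C1_metric|exact: C1_gdetV]. Qed.

Lemma C1_metC : Ck 1 Om metC.
Proof. by apply: (C1M oOm); [exact: C1_metric|exact: C1_gdetV]. Qed.

Lemma met_det p : Om p -> metA p * metC p - metB p ^+ 2 = 1.
Proof.
move=> /OmD Dp; have d0 := gdet_gt0 Dp.
have s0 : Num.sqrt (gdet p) != 0 by rewrite gt_eqF// sqrtr_gt0.
have -> : metA p * metC p - metB p ^+ 2 = gdet p / Num.sqrt (gdet p) ^+ 2.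
  by rewrite /metA /metB /metC {4}/gdet; field.
by rewrite sqr_sqrtr ?ltW// divff// gt_eqF.
Qed.

Lemma metA_gt0 p : Om p -> 0 < metA p.
Proof.
move=> /OmD Dp; rewrite /metA divr_gt0 ?metric11_gt0//.
by rewrite sqrtr_gt0 gdet_gt0.
Qed.

(** The density inside the divergence merges with g^-1 into A; only the outer inverse density
    remains. The fluxes agree on [Om] alone, which suffices for their derivatives as [Om] is
    open. *)
Lemma laplace_beltrami_divA (u : M -> R) x : Om (chart i x) ->
  Ck 2 Om (fun p => u (param i p)) ->
  laplace_beltrami g i u x = - ((volume_density g i (chart i x))^-1 *
    divA metA metB metC (fun p => u (param i p)) (chart i x)).
Proof.
move=> Ox u2; set f := fun p => u (param i p).
rewrite /laplace_beltrami /divergence; congr (- (_ * _)).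
rewrite !big_ord_recl big_ord0 addr0.
have -> : lift ord0 ord0 = i1 :> 'I_2 by exact: val_inj.
have near_Om := open_nbhs_nbhs (conj oOm Ox).
have gradE p : Om p ->
  volume_density g i p * gradient g i f i0 p = flux0 metA metB f p /\
  volume_density g i p * gradient g i f i1 p = flux1 metB metC f p.
  move=> /OmD Dp; have d0 := gdet_gt0 Dp.
  have s0 : Num.sqrt (gdet p) != 0 by rewrite gt_eqF// sqrtr_gt0.
  have dV : (gdet p)^-1 = (Num.sqrt (gdet p))^-1 * (Num.sqrt (gdet p))^-1.
    by rewrite -invfM -expr2 sqr_sqrtr// ltW.
  rewrite /gradient !big_ord_recl !big_ord0 !addr0 volume_densityE// invmx_metric//.
  have -> : lift ord0 ord0 = i1 :> 'I_2 by exact: val_inj.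
  rewrite !mxE /= /flux0 /flux1 /metA /metB /metC.
  by rewrite dV; move: (Num.sqrt _) s0 => s s0; split; field.
have f0 := Ck_is_derive i0 (C1_flux0 oOm C1_metA C1_metB u2) Ox.
have f1 := Ck_is_derive i1 (C1_flux1 oOm C1_metB C1_metC u2) Ox.
rewrite /divA; congr (_ + _); apply: partial_val.
- apply: near_eq_is_derive f0; apply: filterS near_Om => p Op.
  by rewrite (gradE p Op).1.
- apply: near_eq_is_derive f1; apply: filterS near_Om => p Op.
  by rewrite (gradE p Op).2.
Qed.

End metric_coefficients.

(** * The estimates transferred to the surface *)

Section chart_estimates.
Context (R : realType) (M : topologicalType) (S : smooth_surface R M)
  (g : riemannian_metric S) (a b : R).
Hypotheses (a_gt0 : 0 < a) (le_ab : a <= b).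

Definition liouville_solution (eps : R) (V u : M -> R) :=
  [/\ 0 < eps, forall x, a <= V x <= b, C2_on_surface S u &
   forall (i : chart_index S) (x : M), chart_dom i x ->
     laplace_beltrami g i u x + eps = V x * expR (u x)].

Lemma continuous_volume_density (i : chart_index S) p : chart_image i p ->
  {for p, continuous (volume_density g i)}.
Proof.
move=> Dp; have oD : open (chart_image i) := @chart_image_open _ _ S i.
have cd : {for p, continuous (fun p => Num.sqrt (gdet g i p))}.
  apply: (@continuous_comp _ _ _ (gdet g i) (@Num.sqrt R)); last exact: sqrt_continuous.
  exact: Ck_continuous (C1_gdet g oD (subset_refl _)) Dp.
rewrite /prop_for /continuous_at volume_densityE//.
apply: cvg_trans cd; apply: near_eq_cvg.
by apply: filterS (open_nbhs_nbhs (conj oD Dp)) => x /(volume_densityE g) ->.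
Qed.

(** The order of quantifiers is the point: [N] depends only on D and x, and each [C] is chosen
    before eps, V and u. Here l is any lower bound of u on D, to be specialised to the minimum. *)
Lemma chart_estimates (D : set M) (x : M) : open D -> D x ->
  exists2 N, nbhs x N &
  (forall y, N y -> forall W, nbhs y W -> exists2 C, 0 < C &
     forall eps V u l, liouville_solution eps V u -> (forall z, D z -> l <= u z) ->
     forall d, 0 <= d -> (forall z, W z -> l + d <= u z) ->
     forall q, N q -> d <= C * (u q - l + eps)) /\
  (forall c0, 0 < c0 -> exists2 C, 0 < C &
     forall eps V u l p, liouville_solution eps V u -> (forall z, D z -> l <= u z) ->
     N p -> (forall z, u z <= u p) -> c0 <= expR (u p) ->
     forall q, N q -> 1 <= C * (u q - l + eps)).
Proof.
move=> oD Dx; have [i ix] := @chart_dom_cover _ _ S x.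
pose x0 := chart i x; have Dx0 : chart_image i x0 by exists x.
have oI : open (chart_image i) := @chart_image_open _ _ S i.
pose vd := volume_density g i.
have vd0 : 0 < vd x0 := volume_density_gt0 g Dx0.
pose c1 := vd x0 / 2; pose c2 := 2 * vd x0.
have c10 : 0 < c1 by rewrite divr_gt0.
have c20 : 0 < c2 by rewrite mulr_gt0.
(* The part of the chart over D where the area density is pinched between constants, so that div (A
   grad u) = vd (eps - V e^u) has uniform bounds. *)
pose Om := [set p | chart_image i p /\ D (param i p) /\ c1 <= vd p <= c2]^°.
have oOm : open Om := open_interior _.
have Om_sub p : Om p -> chart_image i p /\ D (param i p) /\ c1 <= vd p <= c2.
  by move=> /interior_subset.
have OmD : Om `<=` chart_image i by move=> p /Om_sub[].
have Ox0 : Om x0.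
  have n1 : \forall p \near x0, chart_image i p := open_nbhs_nbhs (conj oI Dx0).
  have n2 : \forall p \near x0, D (param i p).
    apply: (param_continuous Dx0); rewrite /= chartK//.
    exact: (open_nbhs_nbhs (conj oD Dx)).
  have n3 : \forall p \near x0, c1 <= vd p <= c2.
    have /cvgrPdist_le/(_ c1 c10) := continuous_volume_density Dx0.
    by apply: filterS => p; rewrite ler_distl -/vd /c1 /c2 => /andP[? ?]; apply/andP;
      split; lra.
  by rewrite /Om; apply: filterS3 n1 n2 n3 => p.
have A1 := C1_metA g oOm OmD; have B1 := C1_metB g oOm OmD.
have G1 := C1_metC g oOm OmD.
have det1 := @met_det _ _ _ g i Om OmD; have A0 := @metA_gt0 _ _ _ g i Om OmD.
have [r [m tm]] := tame_exists oOm A1 B1 G1 Ox0.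
pose rh := rho r m.
have rh0 : 0 < rh by exact: rho_gt0 tm.
have rhO p : inbox x0 rh p -> Om p by move=> xp; exact: (rho_sub tm xp).
(* Half the box, so that a further box of half side at most rh / 2 around any of its points stays in
   the [rh] box. *)
pose N := [set y | chart_dom i y /\ inbox x0 (rh / 2) (chart i y)].
have Nrh y : N y -> inbox x0 rh (chart i y).
  by move=> [_]; apply: inbox_le; lra.
exists N.
  have n1 : \forall y \near x, chart_dom i y :=
    open_nbhs_nbhs (conj (@chart_dom_open _ _ S i) ix).
  have n2 : \forall y \near x, inbox x0 (rh / 2) (chart i y).
    by apply: (chart_continuous ix); apply: inbox_nbhs; lra.
  by apply: filterS2 n1 n2 => y.
have read eps V u : liouville_solution eps V u ->
    Ck 2 Om (fun p => u (param i p)) /\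
    forall p, Om p -> divA (metA g i) (metB g i) (metC g i) (fun p => u (param i p)) p
      = vd p * (eps - V (param i p) * expR (u (param i p))).
  move=> [_ _ u2 eq]; have f2 := Ck_subset OmD (u2 i); split => // p Op.
  have [[z iz pE] _] := Om_sub _ Op.
  have := eq i z iz; rewrite -pE in Op *;
    rewrite (laplace_beltrami_divA g oOm OmD Op f2) chartK//.
  have v0 : vd (chart i z) != 0 by rewrite gt_eqF// (volume_density_gt0 g (OmD _ Op)).
  rewrite -/vd => <-; field; exact: v0.
have NE (u : M -> R) y : N y -> u (param i (chart i y)) = u y.
  by move=> [iy _]; rewrite chartK.
split.
- have [C C0 H] := positivity_spreads oOm A1 B1 G1 det1 A0 tm.
  move=> y Ny W Wy.
  have : \forall p \near chart i y, W (param i p).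
    have Dy : chart_image i (chart i y) by case: Ny => iy _; exists y.
    by apply: (param_continuous Dy); rewrite /= chartK//; case: Ny.
  move=> /near_inbox[s' s'0 Ws]; pose s := Num.min s' (rh / 2).
  have s0 : 0 < s by rewrite lt_min s'0; lra.
  (* The source bound is K = c2 eps, and w + c2 eps <= (1 + c2) (w + eps) for w >= 0. *)
  exists (C / s ^+ 2 * (1 + c2)).
    by rewrite mulr_gt0 ?divr_gt0 ?exprn_gt0//; lra.
  move=> eps V u l sol lu d d0 Wd q Nq.
  have [f2 dE] := read _ _ _ sol; case: (sol) => eps0 Vab _ _.
  pose v p := 1 * u (param i p) + - l.
  have v2 : Ck 2 Om v := Ck_affine oOm 1 (- l) f2.
  have v0 p : Om p -> 0 <= v p.
    by move=> /Om_sub[_ [Dp _]]; have := lu _ Dp; rewrite /v; lra.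
  have vK p : Om p -> divA (metA g i) (metB g i) (metC g i) v p <= c2 * eps.
    move=> Op; have [_ [_ /andP[w1 w2]]] := Om_sub _ Op.
    rewrite (divA_affine oOm A1 B1 G1)// mul1r dE//.
    have V0 : 0 <= V (param i p) by have /andP[+ _] := Vab (param i p);
      apply: le_trans; exact: ltW.
    have := mulr_ge0 V0 (expR_ge0 (u (param i p))) => VE.
    apply: (@le_trans _ _ (vd p * eps));
      first by rewrite ler_pM2l ?gerBl// (lt_le_trans c10 w1).
    by rewrite ler_pM2r.
  have := H v (c2 * eps) v2 v0 (mulr_ge0 (ltW c20) (ltW eps0)) vK (chart i y) s d
    (chart i q) s0 d0.
  have box p : inbox (chart i y) s p -> inbox x0 rh p /\ d <= v p.
    move=> yp; split.
      have := inbox_trans Ny.2 yp; apply: inbox_le.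
      have : s <= rh / 2 by rewrite ge_min lexx orbT.
      lra.
    have Wp : W (param i p) by apply: Ws; apply: inbox_le yp; rewrite ge_min lexx.
    by have := Wd _ Wp; rewrite /v; lra.
  move=> /(_ box (Nrh _ Nq)); rewrite /v NE// mul1r => H1.
  have vq : 0 <= u q - l.
    have [_ [Dq _]] := Om_sub _ (rhO _ (Nrh _ Nq)).
    by have := lu _ Dq; rewrite NE//; lra.
  rewrite -mulrA mulrAC ler_pdivlMr ?exprn_gt0//; apply: (le_trans H1).
  rewrite ler_pM2l//; have := mulr_ge0 (ltW c20) vq; rewrite mulrDl mul1r mulrDr; lra.
- move=> c0 c00.
  have b_gt0 : 0 < b by apply: lt_le_trans a_gt0 le_ab.
  (* The quotient of the upper bound c2 b e^(u p) for - div (A grad u) by lam = c1 a e^(u p), hence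
     independent of u. *)
  have L0 : 0 <= c2 * b / (c1 * a) by rewrite divr_ge0 ?mulr_ge0 ?ltW.
  have [C C0 H] := max_has_mass oOm A1 B1 G1 det1 A0 tm L0.
  pose ka := Num.min 1 (c1 * a * c0).
  have ka0 : 0 < ka by rewrite lt_min ltr01 !mulr_gt0.
  exists (C / ka * (1 + c2)); first by rewrite mulr_gt0 ?divr_gt0//; lra.
  move=> eps V u l p sol lu Np up cp q Nq.
  have [f2 dE] := read _ _ _ sol; case: (sol) => eps0 Vab _ _.
  pose lam := c1 * a * expR (u p).
  have lam0 : 0 < lam by rewrite !mulr_gt0 ?expR_gt0.
  have := H (fun z => u (param i z)) (c2 * eps) lam (u p) l (chart i p) f2.
  have lum z : Om z -> l <= u (param i z) <= u p.
    by move=> /Om_sub[_ [Dz _]]; rewrite up lu.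
  have lo z : Om z -> lam * expR (u (param i z) - u p) <=
      c2 * eps - divA (metA g i) (metB g i) (metC g i) (fun p => u (param i p)) z.
    move=> Oz; have [_ [_ /andP[w1 w2]]] := Om_sub _ Oz; rewrite dE//.
    have /andP[V1 V2] := Vab (param i z); have E0 := expR_gt0 (u (param i z)).
    have -> : lam * expR (u (param i z) - u p) = c1 * a * expR (u (param i z)).
      by rewrite /lam -mulrA -expRD; congr (_ * expR _); ring.
    have e1 : vd z * eps <= c2 * eps by rewrite ler_pM2r.
    have e2 : c1 * a * expR (u (param i z)) <= vd z * V (param i z) * expR (u (param i z)).
      by rewrite ler_pM2r// ler_pM// ltW.
    rewrite mulrBr mulrA; lra.
  have hi z : Om z -> - divA (metA g i) (metB g i) (metC g i) (fun p => u (param i p)) z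
      <= c2 * b / (c1 * a) * lam.
    move=> Oz; have [_ [_ /andP[w1 w2]]] := Om_sub _ Oz; rewrite dE//.
    have /andP[V1 V2] := Vab (param i z).
    have V0 : 0 <= V (param i z) by exact: le_trans (ltW a_gt0) V1.
    have -> : c2 * b / (c1 * a) * lam = c2 * b * expR (u p).
      by rewrite /lam; field; rewrite !gt_eqF.
    have vz : 0 < vd z by apply: lt_le_trans c10 w1.
    have e1 : vd z * V (param i z) * expR (u (param i z)) <= c2 * b * expR (u p).
      apply: ler_pM; rewrite ?expR_ge0 ?ler_expR//.
        by rewrite mulr_ge0 ?(ltW vz).
      by apply: ler_pM => //; exact: ltW.
    by have := mulr_gt0 vz eps0; rewrite mulrBr mulrA; lra.
  move=> /(_ lum (mulr_ge0 (ltW c20) (ltW eps0)) lam0 (Nrh _ Np) (NE u _ Np) lo hi _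
    (Nrh _ Nq)).
  rewrite NE// => H1.
  have vq : 0 <= u q - l.
    have [_ [Dq _]] := Om_sub _ (rhO _ (Nrh _ Nq)).
    by have := lu _ Dq; rewrite NE//; lra.
  have H2 : ka <= Num.min 1 lam.
    rewrite le_min /ka !ge_min lexx /=; apply/orP; right.
    by rewrite /lam ler_pM2l ?mulr_gt0.
  rewrite -mulrA mulrAC ler_pdivlMr// mul1r; apply: (le_trans H2); apply: (le_trans H1).
  rewrite ler_pM2l//; have := mulr_ge0 (ltW c20) vq; rewrite mulrDl mul1r mulrDr; lra.
Qed.

End chart_estimates.

(** * Connected components of a surface *)

Section surface_topology.
Context (R : realType) (M : topologicalType) (S : smooth_surface R M).

(** A box is the union of the segments that join its points to the centre. *)
Lemma inbox_connected (q : R * R) (s : R) : 0 <= s -> connected (inbox q s).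
Proof.
move=> s0.
have -> : inbox q s = \bigcup_(p in inbox q s)
    ((fun t : R => (q.1 + t * (p.1 - q.1), q.2 + t * (p.2 - q.2))) @` `[0, 1]).
  apply/seteqP; split => [p qp|z [p [p1 p2] [t /=]]].
    exists p => //; exists 1; first by rewrite /= in_itv/= ler01 lexx.
    by case: p qp => *; rewrite /= !mul1r ![_ + (_ - _)]addrC !subrK.
  rewrite in_itv/= => /andP[t0 t1] <-; split => /=.
    rewrite addrAC subrr add0r normrM ger0_norm//.
    by apply: le_trans p1; rewrite ler_piMl.
  rewrite addrAC subrr add0r normrM ger0_norm//.
  by apply: le_trans p2; rewrite ler_piMl.
apply: bigcup_connected.
  exists q => p qp; exists 0; first by rewrite /= in_itv/= lexx ler01.
  by case: (q) => *; rewrite !mul0r !addr0.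
move=> p qp; apply: connected_continuous_connected; first exact: segment_connected.
have lin (c d : R) : continuous (fun t : R => c + t * d).
  move=> t; apply: cvgD; first exact: cvg_cst.
  by apply: cvgM; [exact: cvg_id|exact: cvg_cst].
by apply: continuous_subspaceT => t; exact: (cvg_pair (lin _ _ t) (lin _ _ t)).
Qed.

(** A small coordinate box around a point is mapped by [param] onto a connected neighbourhood, so M
    is locally connected. *)
Lemma component_open (x : M) : open (connected_component [set: M] x).
Proof.
rewrite openE => y xy; have [i iy] := @chart_dom_cover _ _ S y.
have Dy : chart_image i (chart i y) by exists y.
have oI : open (chart_image i) := @chart_image_open _ _ S i.
have [s s0 sI] := near_inbox (open_nbhs_nbhs (conj oI Dy) : \forall p \near _, _).
pose B := param i @` inbox (chart i y) s.
have cB : connected B.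
  apply: connected_continuous_connected; first by apply: inbox_connected; exact: ltW.
  apply: continuous_in_subspaceT => p; rewrite inE => yp.
  exact: param_continuous (sI _ yp).
have By : B y by exists (chart i y); [exact: inbox_refl (ltW s0)|exact: chartK].
have BD : B `<=` connected_component [set: M] x.
  move=> z Bz; apply: connected_component_trans xy _.
  exact: (connected_component_max By).
have n1 : \forall z \near y, chart_dom i z :=
  open_nbhs_nbhs (conj (@chart_dom_open _ _ S i) iy).
have n2 : \forall z \near y, inbox (chart i y) s (chart i z).
  by apply: (chart_continuous iy); exact: inbox_nbhs.
apply: filterS2 n1 n2 => z iz yz; apply: BD.
by exists (chart i z) => //; exact: chartK.
Qed.

Lemma C2_continuous (u : M -> R) : C2_on_surface S u -> continuous u.
Proof.
move=> u2 x; have [i ix] := @chart_dom_cover _ _ S x.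
have Dx : chart_image i (chart i x) by exists x.
have cu : {for chart i x, continuous (fun p => u (param i p))}.
  exact: Ck_continuous (u2 i) Dx.
have cc : u (param i (chart i y)) @[y --> x] --> u (param i (chart i x)).
  apply: (@continuous_comp _ _ _ (chart i) (fun p => u (param i p))).
    exact: chart_continuous ix.
  exact: cu.
rewrite /continuous_at; rewrite chartK// in cc.
apply: cvg_trans cc; apply: near_eq_cvg.
have n1 : \forall z \near x, chart_dom i z :=
  open_nbhs_nbhs (conj (@chart_dom_open _ _ S i) ix).
by apply: filterS n1 => y iy; rewrite chartK.
Qed.

End surface_topology.

(** * Propagation of the lower bound over a component *)

Section no_concentration.
Context (R : realType) (M : topologicalType) (S : smooth_surface R M)
  (g : riemannian_metric S) (compactM : compact [set: M]) (a b : R)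
  (a_gt0 : 0 < a) (le_ab : a <= b) (Veps : R -> M -> R) (u : R -> M -> R).
Hypothesis u_sol : forall eps, 0 < eps ->
  liouville_solution g a b eps (Veps eps) (u eps).

(** The maximum point moves with eps, so the claim concerns all maximum points close to a fixed x0;
    compactness of M then makes it global. This also fixes the component, that of x0, on which to
    work. *)
Lemma max_small_near (c0 : R) (x0 : M) : 0 < c0 ->
  \forall x \near x0 & eps \near 0^'+, (forall z, u eps z <= u eps x) ->
    expR (u eps x) < c0.
Proof.
move=> c00; pose D := connected_component [set: M] x0.
have oD : open D := component_open S x0.
have cD : compact D.
  apply: (subclosed_compact _ compactM) => //.
  by apply: component_closed; exact: closedT.
have Dx0 : D x0 by exact: connected_component_refl.
have pos_eps : \forall eps \near (0 : R)^'+, 0 < eps by exact: nbhs_right_gt.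
have [N nN [_ /(_ c0 c00)[C C0 HB]]] := chart_estimates g a_gt0 le_ab oD Dx0.
pose E eps := exists2 x, N x & (forall z, u eps z <= u eps x) /\ c0 <= expR (u eps x).
suff noE : \forall eps \near (0 : R)^'+, ~ E eps.
  exists (N, [set eps | ~ E eps]) => // -[x eps] [/= Nx nE] mx.
  by rewrite ltNge; apply/negP => cx; apply: nE; exists x.
have minD eps : 0 < eps -> exists2 y, D y & forall z, D z -> u eps y <= u eps z.
  move=> /u_sol[_ _ u2 _].
  have [|y yD ymin] := compact_EVT_min (ex_intro _ x0 Dx0) cD (f := u eps).
    by apply: continuous_subspaceT; exact: C2_continuous u2.
  by exists y; [exact: set_mem|move=> z Dz; apply: ymin; exact: mem_set].
pose lower eps l := forall z, D z -> l <= u eps z.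
(* [W] must not depend on [n], so that the constant of the chart estimate can
   be absorbed by enlarging [n]. *)
pose G : set M := [set x | exists2 W, nbhs x W & forall n : R, 0 <= n ->
  \forall eps \near (0 : R)^'+, E eps -> forall l, lower eps l ->
    forall z, W z -> l + n * eps <= u eps z].
have oG : open G.
  rewrite openE => x [W nW WG]; rewrite /interior.
  have : nbhs x W^° by exact: nbhs_interior.
  by apply: filterS => y yW; exists W.
have Gx0 : G x0.
  exists N => // n n0.
  near=> eps => -[x Nx [mx cx]] l lu z Nz.
  have eps0 : 0 < eps by near: eps.
  have := HB _ _ _ l x (u_sol eps0) lu Nx mx cx z Nz.
  (* The mass estimate 1 <= C (u - l + eps) then gives (n + 1) eps <= u - l + eps, that is u >= l +
     n eps. *)
  have small : eps * (C * (n + 1)) <= 1.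
    rewrite -ler_pdivlMr ?mulr_gt0 ?ltr_wpDl//; near: eps.
    by apply: nbhs_right_le; rewrite divr_gt0// mulr_gt0// ltr_wpDl.
  move=> /(le_trans small); rewrite mulrCA ler_pM2l// mulrDr mulr1 [eps * n]mulrC.
  by rewrite lerD2r lerBrDl.
(* G meets D and is both open and closed relatively to the connected set D. *)
have GD : D `&` G = D.
  apply: (component_connected (A := [set: M]) (x := x0)).
  - by exists x0.
  - by exists G.
  - exists (closure G); first exact: closed_closure.
    apply/seteqP; split => [x [Dx Gx]|x [Dx clGx]]; split => //.
      exact: subset_closure.
    have [N' nN' [HA _]] := chart_estimates g a_gt0 le_ab oD Dx.
    have [y [[W nW WG] N'y]] := clGx _ nN'.
    have [C' C'0 HC] := HA y N'y W nW.
    exists N' => // n n0.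
    (* Asking for the multiple C' (n + 1) of eps on W pays for the loss: dividing by C' leaves (n +
       1) eps <= u - l + eps on N'. *)
    have k0 : 0 <= C' * (n + 1) by rewrite mulr_ge0 ?(ltW C'0) ?addr_ge0.
    near=> eps => Ee l lu z N'z.
    have eps0 : 0 < eps by near: eps.
    have Wz : forall z, W z -> l + C' * (n + 1) * eps <= u eps z.
      by move: Ee l lu {N'z}; near: eps; exact: WG.
    have := HC _ _ _ l (u_sol eps0) lu _ (mulr_ge0 k0 (ltW eps0)) Wz z N'z.
    by rewrite -mulrA ler_pM2l// mulrDl mul1r lerD2r lerBrDl.
(* Compactness gives one threshold for eps valid on all of D, with n = 1. Taking for l the minimum
   of u over D then yields l + eps <= l at the minimum point. *)
have /compact_near_coveringP cov := cD.
have lift1 : \forall eps \near (0 : R)^'+,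
    D `<=` (fun x => E eps -> forall l, lower eps l -> l + 1 * eps <= u eps x).
  apply: cov => x Dx.
  have [_ [W nW /(_ 1 ler01) WG]] : (D `&` G) x by rewrite GD.
  by exists (W, [set eps | E eps -> forall l, lower eps l -> forall z, W z ->
    l + 1 * eps <= u eps z])
    => // -[y eps] [/= Wy H] Ee l lu; exact: H.
near=> eps => Ee; have eps0 : 0 < eps by near: eps.
have [y Dy ymin] := minD _ eps0.
have above : D `<=` (fun x => E eps -> forall l, lower eps l -> l + 1 * eps <= u eps x).
  by move: Ee {y Dy ymin}; near: eps; apply: filterS lift1.
by have := above y Dy Ee _ ymin; rewrite gerDl leNgt mul1r eps0.
Unshelve. all: by end_near. Qed.

End no_concentration.

Theorem theorem1p1 (R : realType) (M : topologicalType)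
  (S : smooth_surface R M) (g : riemannian_metric S)
  (hausdorffM : hausdorff_space M) (compactM : compact [set: M])
  (a b : R) (a_gt0 : 0 < a) (le_ab : a <= b)
  (Veps : R -> M -> R) (V : M -> R) (u : R -> M -> R)
  (Veps_hoelder : forall eps, 0 < eps -> hoelder_continuous g (Veps eps))
  (Veps_bounds : forall eps, 0 < eps -> forall x, a <= Veps eps x <= b)
  (Veps_cvg :
     Linfty_norm S (fun x => Veps eps x - V x) @[eps --> 0^'+] --> 0%E)
  (u_C2 : forall eps, 0 < eps -> C2_on_surface S (u eps))
  (u_sol : forall eps, 0 < eps ->
     forall (i : chart_index S) (x : M), chart_dom i x ->
       laplace_beltrami g i (u eps) x + eps = Veps eps x * expR (u eps x)) :
  ereal_sup [set (u eps x)%:E | x in [set: M]] @[eps --> 0^'+] --> -oo%E.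
Proof.
have sol eps : 0 < eps -> liouville_solution g a b eps (Veps eps) (u eps).
  by move=> e0; split=> //; [exact: Veps_bounds|exact: u_C2|exact: u_sol].
apply/cvgeNyPler => A _.
have /compact_near_coveringP cov := compactM.
have small : \forall eps \near (0 : R)^'+, [set: M] `<=`
    (fun x => (forall z, u eps z <= u eps x) -> expR (u eps x) < expR A).
  by apply: cov => x _; apply: (max_small_near compactM a_gt0 le_ab sol); exact: expR_gt0.
near=> eps; apply: ub_ereal_sup => _ [x _ <-]; rewrite lee_fin.
have eps0 : 0 < eps by near: eps; exact: nbhs_right_gt.
have [_ _ u2 _] := sol _ eps0.
have [|||p _ pmax] := @compact_EVT_max M R (u eps) [set: M].
- by exists x.
- exact: compactM.
- by apply: continuous_subspaceT; exact: C2_continuous u2.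
have pm z : u eps z <= u eps p by apply: pmax; exact: mem_set.
have H : [set: M] `<=` (fun x => (forall z, u eps z <= u eps x) -> expR (u eps x) < expR A).
  by near: eps.
by have := H p I pm; rewrite ltr_expR => /ltW; apply: le_trans.
Unshelve. all: by end_near. Qed.
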